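(* Let $Q$ be a Radon measure on the non-negative real line whose Laplace transform $L(t)=\int_{[0,+\infty)}e^{-ty}Q(dy)$ is finite for all $t>0$, and let $(Q_{-t})_{t>0}$ be the exponential family generated by $Q$, $Q_{-t}(dy)=\frac{e^{-ty}}{L(t)}Q(dy)$, $t>0$. Let $\alpha\in(0,1)$ and $a>0$, and suppose that $a/t$ is an $\alpha$-quantile of $Q_{-t}$ for $t>0$, that is $$\int_{(0,a/t)}e^{-ty}Q(dy)\leq \alpha L(t)\leq \int_{(0,a/t]}e^{-ty}Q(dy),\qquad t>0.$$ Then $Q$ is proportional to $Q^{p^*}$, where $Q^{p}(dy)=\frac{1}{\Gamma(p)}y^{p-1}dy$ for $p>0$, and $p^*=p^*(\alpha)$ is the unique solution in $p>0$ of the equation $E_p(a)=\alpha$, $E_p$ being the distribution function of $\mathrm{Ga}(p,1)$. In addition, $Q_{-t}=\mathrm{Ga}(p^*,t/a)$.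
   Context: For $p>0$ and $t>0$, $\mathrm{Ga}(p,t)$ denotes the gamma law with parameters $p$ and $t$, i.e. the probability on $(0,\infty)$ with density $\frac{t^p}{\Gamma(p)}y^{p-1}e^{-ty}$; it is the member with parameter $-t$ of the exponential family generated by $Q^p$. In particular $E_p(a)=\frac{1}{\Gamma(p)}\int_0^a y^{p-1}e^{-y}dy$.
   Formalization: The last formula is corrected to Q_{-t} = Ga(p*, t): as printed, Ga(p*, t/a) fails for every a ≠ 1 (take Q = Q^{p*}). Q is also assumed to be nonzero, since otherwise Q_{-t} is undefined. *)

(* Defs.v *)
(* MathComp-Analysis *)
From HB Require Import structures.
From mathcomp Require Import all_boot all_order all_algebra.
From mathcomp Require Import all_classical all_reals all_analysis.

Set Implicit Arguments.
Unset Strict Implicit.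
Unset Printing Implicit Defensive.

Import Order.TTheory GRing.Theory Num.Theory.
Import numFieldNormedType.Exports.

Local Open Scope classical_set_scope.
Local Open Scope ring_scope.

(* A measure on [0, +oo) is a Borel measure on R that does not charge the
   negative half-line; an atom at 0 is allowed.  A Borel measure on the line
   that is finite on compact sets is automatically regular. *)
Definition radon_nonneg (R : realType)
    (Q : {measure set (measurableTypeR R) -> \bar R}) : Prop :=
  Q (`]-oo, 0[%classic : set R) = 0%E /\
  forall K : set R, compact K -> (Q K < +oo)%E.

Definition laplace (R : realType)
    (Q : {measure set (measurableTypeR R) -> \bar R}) (t : R) : \bar R :=
  (\int[Q]_(y in `[0%R, +oo[) (expR (- (t * y)))%:E)%E.

(* The member Q_{-t}, of parameter -t, of the exponential family generated by
   Q, as a function of Borel sets; meaningful when laplace Q t is finite and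
   nonzero. *)
Definition exp_family (R : realType)
    (Q : {measure set (measurableTypeR R) -> \bar R}) (t : R)
    (A : set (measurableTypeR R)) : \bar R :=
  (\int[Q]_(y in A) (expR (- (t * y)) / fine (laplace Q t))%:E)%E.

Definition Gamma (R : realType) (p : R) : R :=
  \int[@lebesgue_measure R]_(y in `]0, +oo[) (y `^ (p - 1) * expR (- y)).

(* Q^p; the origin is left out because 0 `^ 0 = 1 and 0 `^ r = 0 otherwise. *)
Definition power_measure (R : realType) (p : R)
    (A : set (measurableTypeR R)) : \bar R :=
  (\int[@lebesgue_measure R]_(y in A `&` `]0%R, +oo[)
     (y `^ (p - 1) / Gamma p)%:E)%E.

(* Ga(p, t), with shape p and rate t. *)
Definition gamma_law (R : realType) (p t : R)
    (A : set (measurableTypeR R)) : \bar R :=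
  (\int[@lebesgue_measure R]_(y in A `&` `]0%R, +oo[)
     (t `^ p / Gamma p * y `^ (p - 1) * expR (- (t * y)))%:E)%E.

(* E_p, the distribution function of Ga(p, 1). *)
Definition gamma_cdf (R : realType) (p x : R) : \bar R :=
  gamma_law p 1 (`]-oo, x]%classic : set R).

(* Main.v *)
(* Put H(x) = (1[x <= a] - alpha) exp(-x).  Letting t vary, the two quantile
   inequalities become the single equation: int H(ty) Q(dy) = 0 for all t > 0,
   and Q has no atom at 0.  Integrating it in t against dt / t^2 shows that Q has
   the density y^-1 exp(a) Z(a/y), where Z(s) = int K(sy) Q(dy) and the kernel
   K(x) = (a - x) H(x) is nonnegative.  The Mellin transform of H vanishes at
   exactly one point p, the solution of E_p(a) = alpha, so y^(p-1) dy solves the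
   same equation, and the primitive G of x^(p-1) H(x) that vanishes at infinity
   is nonnegative.  Then t |-> int G(ty) y^-p Q(dy) is constant, which bounds the
   normalized density exp(a) Z(a/y) y^-p.  With M its supremum, q(y) dy =
   M y^(p-1) dy - Q(dy) is a nonnegative solution whose normalized density has
   infimum 0.
   Suppose q is not zero.  Then int G(ty) y^-p q(y) dy is a positive constant, and
   comparing G with K(ay/r) + K(ay/r') shows that the normalized densities at r
   and at r' >= 2r have a sum bounded below.  So if the density is small at r, it
   is large on ]2r, 4r], and the density equation at r then bounds it from below
   at r as well: its infimum is positive, a contradiction. *)
Require Import Defs.
From HB Require Import structures.
From mathcomp Require Import all_boot all_order all_algebra.
From mathcomp Require Import all_classical all_reals all_analysis.
From mathcomp Require Import measurable_realfun ring lra.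
Import Order.TTheory GRing.Theory Num.Theory.
Import numFieldNormedType.Exports.
Local Open Scope classical_set_scope.
Local Open Scope ring_scope.

Set Implicit Arguments.
Unset Strict Implicit.
Unset Printing Implicit Defensive.

(** * Real-valued integrals *)

(** In the multiplicative variable the balance equation is a convolution equation whose kernel
    changes sign, so the nonnegativity of Q gives nothing directly. K and G keep the equation and
    are nonnegative. For K: as a function of r, H(ay/r) has derivative (ay/r^2) H(ay/r), apart from
    an upward jump exp(-a) at r = y. The jump recovers Q; the derivative contributes the kernel -x
    H(x), to which a H(x), of integral zero, is added, and a - x changes sign exactly where H does.
    For G, nonnegativity comes from its vanishing at 0 and at infinity, H being positive up to a and
    negative after. What remains is a maximum principle. The infimum of the normalized density need
    not be attained, so pointwise positivity is not enough and the bounds must be uniform in r;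
    hence every estimate below carries the right power of the scale, with a constant free of it.
    Since K(ay/r) vanishes at y = r, a small density at r is compatible with mass concentrated near
    r, and a single radius cannot be conclusive. *)

Section Rintegral_facts.
Context d (T : measurableType d) (R : realType).
Variable mu : {measure set T -> \bar R}.

Lemma integrable_EFinE D (f : T -> R) : measurable D -> mu.-integrable D (EFin \o f) ->
  (\int[mu]_(x in D) (f x)%:E = (\int[mu]_(x in D) f x)%:E)%E.
Proof. by move=> mD If; rewrite /Rintegral fineK//; exact: integrable_fin_num. Qed.

Lemma le_integrable_EFin D (f g : T -> R) : measurable D -> measurable_fun D f ->
  (forall x, D x -> `|f x| <= g x) ->
  mu.-integrable D (EFin \o g) -> mu.-integrable D (EFin \o f).
Proof.
move=> mD mf fg; apply: le_integrable => //; first exact/measurable_EFinP.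
by move=> x Dx /=; rewrite lee_fin (le_trans (fg _ Dx))// ler_norm.
Qed.

Lemma ge0_integrable_EFin D (f : T -> R) : measurable D -> measurable_fun D f ->
  (forall x, D x -> 0 <= f x) -> (\int[mu]_(x in D) (f x)%:E < +oo)%E ->
  mu.-integrable D (EFin \o f).
Proof.
move=> mD mf f0 foo; apply/integrableP; split; first exact/measurable_EFinP.
rewrite (eq_integral (fun x => (f x)%:E))// => x /[!inE] Dx /=.
by rewrite ger0_norm// f0.
Qed.

Lemma integrable_EFinD D (f g : T -> R) : measurable D ->
  mu.-integrable D (EFin \o f) -> mu.-integrable D (EFin \o g) ->
  mu.-integrable D (EFin \o (fun x => f x + g x)).
Proof. by move=> mD If Ig; exact: (integrableD mD If Ig). Qed.

Lemma integrable_EFinB D (f g : T -> R) : measurable D ->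
  mu.-integrable D (EFin \o f) -> mu.-integrable D (EFin \o g) ->
  mu.-integrable D (EFin \o (fun x => f x - g x)).
Proof. by move=> mD If Ig; exact: (integrableB mD If Ig). Qed.

Lemma integrable_EFinZ D (c : R) (f : T -> R) : measurable D ->
  mu.-integrable D (EFin \o f) -> mu.-integrable D (EFin \o (fun x => c * f x)).
Proof. by move=> mD If; exact: (integrableZl mD c If). Qed.

Lemma le_subset_Rintegral A D (f g : T -> R) : measurable A -> measurable D ->
  A `<=` D -> mu.-integrable D (EFin \o f) -> mu.-integrable A (EFin \o g) ->
  (forall x, D x -> 0 <= f x) -> (forall x, A x -> g x <= f x) ->
  \int[mu]_(x in A) g x <= \int[mu]_(x in D) f x.
Proof.
move=> mA mD AD If Ig f0 gf.
have IfA := integrableS mD mA AD If.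
apply: (le_trans (le_Rintegral mA Ig IfA gf)).
rewrite -lee_fin -!integrable_EFinE//.
apply: ge0_subset_integral => //; first exact: measurable_int If.
Qed.

Lemma Rintegral_eq0_ae D (f : T -> R) : measurable D ->
  mu.-integrable D (EFin \o f) -> (forall x, D x -> 0 <= f x) ->
  \int[mu]_(x in D) f x = 0 -> ae_eq mu D (EFin \o f) (cst 0%E).
Proof.
move=> mD If f0 f00; apply/ae_eq_integral_abs => //; first exact: measurable_int If.
rewrite (eq_integral (fun x => (f x)%:E)); last first.
  by move=> x /[!inE] Dx /=; rewrite ger0_norm// f0.
by rewrite integrable_EFinE// f00.
Qed.

End Rintegral_facts.

Section Fubini.
Context d1 d2 (T1 : measurableType d1) (T2 : measurableType d2) (R : realType).
Variable m1 : {sigma_finite_measure set T1 -> \bar R}.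
Variable m2 : {sigma_finite_measure set T2 -> \bar R}.

(** Tonelli applies to the positive and to the negative part; as [fine] is measurable, sections with
    an infinite integral do no harm. *)
Lemma measurable_Rintegral2 (B : set T2) (f : T1 * T2 -> R) : measurable B ->
  measurable_fun setT f ->
  measurable_fun setT (fun x => \int[m2]_(y in B) f (x, y)).
Proof.
move=> mB mf; rewrite /Rintegral; apply: measurableT_comp => /=; first exact: fine_measurable.
pose g (z : T1 * T2) : \bar R := (f z * \1_B z.2)%:E.
have mg : measurable_fun setT g.
  apply/measurable_EFinP; apply: measurable_funM => //.
  exact: measurableT_comp.
have -> : (fun x => \int[m2]_(y in B) (f (x, y))%:E)%E =
    (fun x => \int[m2]_y g^\+ (x, y) - \int[m2]_y g^\- (x, y))%E.
  apply/funext => x; rewrite integral_mkcond integralE; congr (_ - _)%E;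
  apply: eq_integral => y _; rewrite ?funeposE ?funenegE /g /= patchE indicE;
    by case: ifPn => //= _; rewrite ?mulr1 ?mulr0.
apply: emeasurable_funB; apply: measurable_fun_fubini_tonelli_F => //.
  exact: measurable_funepos.
exact: measurable_funeneg.
Qed.

(** Domination by a product of two integrable functions gives integrability on A x B. Multiplying by
    the indicators of A and B turns all integrals into integrals over the whole spaces. *)
Lemma Fubini_dominated A B (f : T1 * T2 -> R) (g : T1 -> R) (h : T2 -> R) :
  measurable A -> measurable B -> measurable_fun setT f ->
  m1.-integrable A (EFin \o g) -> m2.-integrable B (EFin \o h) ->
  (forall x y, A x -> B y -> `|f (x, y)| <= g x * h y) ->
  \int[m1]_(x in A) \int[m2]_(y in B) f (x, y) =
  \int[m2]_(y in B) \int[m1]_(x in A) f (x, y).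
Proof.
move=> mA mB mf Ig Ih fgh.
pose F (z : T1 * T2) : \bar R := (f z * (\1_A z.1 * \1_B z.2))%:E.
have mF : measurable_fun setT F.
  apply/measurable_EFinP; apply: measurable_funM => //.
  by apply: measurable_funM; exact: measurableT_comp.
have sec1 x : A x -> m2.-integrable B (EFin \o (fun y => f (x, y))).
  move=> Ax; apply: (le_integrable_EFin mB (g := fun y => g x * h y)).
  - by apply/measurable_funTS; exact: measurableT_comp.
  - by move=> y By; exact: fgh.
  - exact: integrable_EFinZ.
have sec2 y : B y -> m1.-integrable A (EFin \o (fun x => f (x, y))).
  move=> By; apply: (le_integrable_EFin mA (g := fun x => h y * g x)).
  - by apply/measurable_funTS; exact: measurableT_comp.
  - by move=> x Ax; rewrite mulrC; exact: fgh.
  - exact: integrable_EFinZ.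
have F12 x : (\int[m2]_y F (x, y) =
    ((fun x => (\int[m2]_(y in B) f (x, y))%:E) \_ A) x)%E.
  rewrite patchE; case: ifPn => [|xA]; last first.
    by rewrite integral0_eq// => y _; rewrite /F/= indicE (negbTE xA) mul0r mulr0.
  rewrite inE => Ax; rewrite -(integrable_EFinE mB (sec1 _ Ax)) [RHS]integral_mkcond.
  apply: eq_integral => y _; rewrite /F/= patchE !indicE (mem_set Ax) mul1r.
  by case: ifPn => //= _; rewrite ?mulr1 ?mulr0.
have F21 y : (\int[m1]_x F (x, y) =
    ((fun y => (\int[m1]_(x in A) f (x, y))%:E) \_ B) y)%E.
  rewrite patchE; case: ifPn => [|yB]; last first.
    by rewrite integral0_eq// => x _; rewrite /F/= [X in _ * (_ * X)]indicE (negbTE yB) !mulr0.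
  rewrite inE => By; rewrite -(integrable_EFinE mA (sec2 _ By)) [RHS]integral_mkcond.
  apply: eq_integral => x _; rewrite /F/= patchE !indicE (mem_set By) mulr1.
  by case: ifPn => //= _; rewrite ?mulr1 ?mulr0.
have : (\int[m1]_x \int[m2]_y F (x, y) = \int[m2]_y \int[m1]_x F (x, y))%E.
  apply: Fubini; apply/integrable12ltyP => //.
  have Ina : m1.-integrable A (EFin \o (fun z => `|g z|)) by exact: integrable_norm.
  have Inb : m2.-integrable B (EFin \o (fun z => `|h z|)) by exact: integrable_norm.
  apply: (@le_lt_trans _ _ (\int[m1]_(x in A) (`|g x| * \int[m2]_(y in B) `|h y|)%:E)%E); last first.
    under eq_integral do rewrite mulrC.
    apply: integrable_lty => //.
    exact: (integrable_EFinZ _ mA Ina).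
  rewrite [leRHS]integral_mkcond; apply: ge0_le_integral => //.
  - by move=> x _; exact: integral_ge0.
  - by apply: (measurable_fun_fubini_tonelli_F (abse \o F)) => //=; exact: measurableT_comp.
  - apply/(measurable_restrictT _ mA).1/measurable_EFinP; apply: measurable_funM => //.
    by have /measurable_int/measurable_EFinP := Ina.
  move=> x _; rewrite patchE; case: ifPn => [|xA]; last first.
    by rewrite integral0_eq// => y _; rewrite /F/= indicE (negbTE xA) mul0r mulr0 normr0.
  rewrite inE => Ax; rewrite -RintegralZl// -integrable_EFinE//; last first.
    exact: integrable_EFinZ.
  rewrite [leRHS]integral_mkcond; apply: ge0_le_integral => //.
  - by apply: measurableT_comp => //; apply: measurableT_comp.
  - apply/(measurable_restrictT _ mB).1/measurable_EFinP; apply: measurable_funM => //.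
    by have /measurable_int/measurable_EFinP := Inb.
  move=> y _; rewrite patchE; case: ifPn => [|yB]; last first.
    by rewrite /F/= [X in _ * (_ * X)]indicE (negbTE yB) !mulr0 normr0.
  rewrite inE => By; rewrite /F/= lee_fin !indicE (mem_set Ax) (mem_set By) !mulr1.
  by rewrite (le_trans (fgh _ _ Ax By))// -normrM ler_norm.
under eq_integral do rewrite F12.
under [X in _ = X -> _]eq_integral do rewrite F21.
by rewrite -!integral_mkcond /Rintegral => ->.
Qed.

End Fubini.

(** * Scaling and densities *)

Section scaling.
Context (R : realType).
Variable c : R.
Hypothesis c_gt0 : 0 < c.
Notation mu := (@lebesgue_measure R).
Notation D := (`]0, +oo[%classic : set R).

Let phi : measurableTypeR R -> measurableTypeR R := *%R c.

Let mphi : measurable_fun [set: measurableTypeR R] phi.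
Proof. exact: mulrl_measurable. Qed.

Lemma lebesgue_measure_scale (A : set R) : measurable A ->
  mu A = (c%:E * mu (phi @^-1` A))%E.
Proof.
move=> mA; have -> : (c%:E * mu (phi @^-1` A))%E =
  mscale (NngNum (ltW c_gt0)) (pushforward mu phi) A by [].
apply: lebesgue_measure_unique => //= _ [[u v]] _ <-.
rewrite /mscale/= /pushforward (_ : _ @^-1` _ = `]u / c, v / c]%classic); last first.
  apply/seteqP; split => x; rewrite /phi/= !in_itv/=.
    by rewrite ltr_pdivrMr// ler_pdivlMr// ![_ * c]mulrC.
  by rewrite ltr_pdivrMr// ler_pdivlMr// ![_ * c]mulrC.
rewrite !lebesgue_measure_itv/= !lte_fin ltr_pM2r ?invr_gt0//.
case: ifPn => _; last by rewrite mule0.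
by rewrite -!EFinD -EFinM mulrBr !mulrA ![c * _]mulrC !mulfK// gt_eqF.
Qed.

Let preD : phi @^-1` D = D.
Proof. by apply/seteqP; split => x; rewrite /phi/= !in_itv/= !andbT pmulr_rgt0. Qed.

Lemma ge0_integral_scale (f : R -> \bar R) : measurable_fun D f ->
  (forall x, D x -> 0 <= f x)%E ->
  (\int[mu]_(x in D) f x = c%:E * \int[mu]_(x in D) f (c * x)%R)%E.
Proof.
move=> mf f0.
rewrite (eq_measure_integral (mscale (NngNum (ltW c_gt0)) (pushforward mu phi))).
  rewrite ge0_integral_mscale//= ge0_integral_pushforward//=.
  - by rewrite preD.
  - by move=> x /[!inE]; exact: f0.
by move=> A mA _; exact: lebesgue_measure_scale.
Qed.

Let mcomp (f : R -> R) : measurable_fun D f -> measurable_fun D (fun x => f (c * x)).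
Proof.
move=> mf; apply: (measurable_comp (F := D) (g := phi)) => //.
- by move=> _ [x Dx <-]; rewrite -preD in Dx.
- exact: (measurable_funTS mphi).
Qed.

Lemma integrable_scale (f : R -> R) : mu.-integrable D (EFin \o f) ->
  mu.-integrable D (EFin \o (fun x => f (c * x))).
Proof.
move=> /integrableP[/measurable_EFinP mf foo]; apply/integrableP; split.
  by apply/measurable_EFinP; exact: mcomp.
move: foo; rewrite ge0_integral_scale//; last first.
  by apply/measurable_EFinP; exact: measurableT_comp.
rewrite !ltey; apply: contra => /eqP /= ->.
by rewrite gt0_muley ?lte_fin.
Qed.

Lemma Rintegral_scale (f : R -> R) : mu.-integrable D (EFin \o f) ->
  \int[mu]_(x in D) f (c * x) = c^-1 * \int[mu]_(x in D) f x.
Proof.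
move=> If; have If' := integrable_scale If.
have /integrableP[/measurable_EFinP mf _] := If.
apply: (mulfI (lt0r_neq0 c_gt0)); rewrite mulVKf ?gt_eqF//.
apply: EFin_inj; rewrite EFinM -!integrable_EFinE// integralE [in RHS]integralE.
rewrite muleBr//; last first.
  by apply: fin_num_adde_defl; rewrite fin_numN integrable_neg_fin_num.
have mEf : measurable_fun D (EFin \o f) by exact/measurable_EFinP.
rewrite [in RHS](ge0_integral_scale (measurable_funepos mEf))//.
rewrite [in RHS](ge0_integral_scale (measurable_funeneg mEf))//.
congr (_ - _)%E; congr (_ * _)%E; apply: eq_integral => x _.
  by rewrite !funeposE.
by rewrite !funenegE.
Qed.

End scaling.

Section density.
Context d (T : measurableType d) (R : realType).
Variable mu : {measure set T -> \bar R}.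
Variable g : T -> R.
Hypotheses (mg : measurable_fun setT g) (g0 : forall x, 0 <= g x).

(** The proofs of measurability and nonnegativity are arguments, so that the measure structure can
    be inferred from the term [mdensity mg g0] itself. *)
Definition mdensity of measurable_fun setT g & (forall x, 0 <= g x) :=
  fun A : set T => (\int[mu]_(x in A) (g x)%:E)%E.

Let mdensity0 : mdensity mg g0 set0 = 0%E.
Proof. exact: integral_set0. Qed.

Let mdensity_ge0 A : (0 <= mdensity mg g0 A)%E.
Proof. by apply: integral_ge0 => x _; rewrite lee_fin. Qed.

Let mdensity_sigma_additive : semi_sigma_additive (mdensity mg g0).
Proof.
move=> /= F mF tF mUF; rewrite /mdensity; apply: cvg_toP.
  apply: ereal_nondecreasing_is_cvgn => m n mn.
  by apply: lee_sum_nneg_natr => // k _ _; exact: mdensity_ge0.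
rewrite ge0_integral_bigcup//=.
- by apply/measurable_funTS/measurable_EFinP.
- by move=> x _; rewrite lee_fin.
Qed.

HB.instance Definition _ := isMeasure.Build _ _ _
  (mdensity mg g0) mdensity0 mdensity_ge0 mdensity_sigma_additive.

End density.

Section integral_density.
Context d (T : measurableType d) (R : realType).
Variables nu mu : {measure set T -> \bar R}.
Variables (D : set T) (g : T -> R).
Hypotheses (mD : measurable D) (mg : measurable_fun setT g).
Hypothesis g0 : forall x, 0 <= g x.
Hypothesis nuE : forall A, measurable A -> A `<=` D ->
  (nu A = \int[mu]_(x in A) (g x)%:E)%E.

Import HBNNSimple.
Local Open Scope ereal_scope.

(** [nuE] speaks of subsets of [D] only, so [nu] may be arbitrary elsewhere. The identity passes
    from indicators to simple functions, then to increasing limits. *)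
Lemma ge0_integral_density (f : T -> \bar R) : measurable_fun D f ->
  (forall x, D x -> 0 <= f x) ->
  \int[nu]_(x in D) f x = \int[mu]_(x in D) (f x * (g x)%:E).
Proof.
move=> mf f0; have mgD := measurable_funTS (D := D) mg.
pose h := nnsfun_approx mD mf.
have fE x : D x -> (EFin \o h n) x @[n --> \oo] --> f x.
  by move=> Dx; exact: cvg_nnsfun_approx.
have -> : \int[nu]_(x in D) f x = limn (fun n => \int[nu]_(x in D) (h n x)%:E).
  rewrite -monotone_convergence//=.
  - by apply: eq_integral => x /[!inE] Dx; apply/esym/cvg_lim => //; exact: fE.
  - by move=> n; apply/measurable_EFinP/measurable_funTS; exact: measurable_funP.
  - by move=> n x Dx; rewrite lee_fin.
  - by move=> x Dx a b ab; rewrite lee_fin; exact/lefP/nd_nnsfun_approx.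
have -> : \int[mu]_(x in D) (f x * (g x)%:E) =
    limn (fun n => \int[mu]_(x in D) ((h n x)%:E * (g x)%:E)).
  rewrite -monotone_convergence//=.
  - apply: eq_integral => x /[!inE] Dx; apply/esym/cvg_lim => //.
    by apply: cvgeZr => //; exact: fE.
  - move=> n; apply: emeasurable_funM; last exact/measurable_EFinP.
    by apply/measurable_EFinP/measurable_funTS; exact: measurable_funP.
  - by move=> n x Dx; rewrite mule_ge0// lee_fin.
  - move=> x Dx a b ab; rewrite lee_wpmul2r ?lee_fin//.
    exact/lefP/nd_nnsfun_approx.
congr (limn _); apply/funext => n; set s := h n.
have mpre r : measurable (D `&` s @^-1` [set r]) by exact: measurableI.
transitivity (\int[nu]_(x in D)
   (\sum_(r \in range s) (r * \1_(s @^-1` [set r]) x)%:E)).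
  by apply: eq_integral => x _; rewrite /= fimfunE -fsumEFin.
rewrite ge0_integral_fsum//; last 2 first.
  - move=> r; apply/measurable_EFinP/measurable_funM => //.
  - by move=> r x _; exact: nnfun_muleindic_ge0.
transitivity (\int[mu]_(x in D)
   (\sum_(r \in range s) ((r * \1_(s @^-1` [set r]) x)%:E * (g x)%:E))); last first.
  apply: eq_integral => x _; rewrite [in RHS]fimfunE -fsumEFin//.
  by rewrite ge0_mule_fsuml// => r; exact: nnfun_muleindic_ge0.
rewrite ge0_integral_fsum//; last 2 first.
  - move=> r; apply: emeasurable_funM; last exact/measurable_EFinP.
    by apply/measurable_EFinP/measurable_funM.
  - by move=> r x _; rewrite mule_ge0 ?lee_fin// -lee_fin nnfun_muleindic_ge0.
apply: eq_fsbigr => r /[!inE] -[x0 _ rE].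
have r0 : (0 <= r)%R by rewrite -rE.
rewrite integralZl_indic_nnsfun// integral_indic// setIC nuE//.
under [RHS]eq_integral do rewrite EFinM -muleA.
rewrite ge0_integralZl//; last 2 first.
  - by apply: emeasurable_funM; exact/measurable_EFinP.
  - by move=> x _; rewrite mule_ge0 ?lee_fin.
congr (_ * _); rewrite integral_mkcondr; apply: eq_integral => x _.
by rewrite patchE indicE; case: ifPn => _; rewrite ?mul1e ?mul0e.
Qed.

End integral_density.

(** * The half-line, power functions and exponentials *)

Section real_line.
Context (R : realType).
Notation leb := (@lebesgue_measure R).
Notation D := (`]0, +oo[%classic : set R).

Let mD : measurable (D : set (measurableTypeR R)).
Proof. exact: measurable_itv. Qed.

(** Continuity from below extends the agreement to intervals starting at 0. After restriction to the
    half-line, the intervals ]-k, k] exhaust the line with finite measure, and the uniqueness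
    theorem for measures on half-open intervals applies. *)
Lemma measure_unique_pos (m1 m2 : {measure set (measurableTypeR R) -> \bar R}) :
  (forall u v : R, 0 < u -> u < v -> m1 `]u, v]%classic = m2 `]u, v]%classic) ->
  (forall v : R, 0 < v -> (m1 `]0%R, v]%classic < +oo)%E) ->
  forall A, measurable A -> A `<=` D -> m1 A = m2 A.
Proof.
move=> m12 m1oo A mA AD.
have E0 v : 0 < v -> m1 `]0, v]%classic = m2 `]0, v]%classic.
  (* With [n.+2] the left end stays strictly below [v] even for n = 0, as [m12] demands. *)
  move=> v0; pose F n := `]v / n.+2%:R, v]%classic : set (measurableTypeR R).
  have FE : `]0, v]%classic = \bigcup_n F n.
    apply/seteqP; split => [x|x [n _]]; rewrite /F/= !in_itv/=; last first.
      by move=> /andP[/(lt_trans _)-> //]; rewrite divr_gt0.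
    move=> /andP[x0 xv]; exists (Num.truncn (v / x)) => //=.
    rewrite in_itv/= xv andbT ltr_pdivrMr// -ltr_pdivrMl// mulrC.
    by rewrite (lt_trans (truncnS_gt _))// ltr_nat.
  have Fnd : nondecreasing_seq F.
    apply/nondecreasing_seqP => n; apply/subsetPset => x; rewrite /F/= !in_itv/=.
    move=> /andP[xn ->]; rewrite andbT (le_lt_trans _ xn)// ler_pM2l//.
    by rewrite lef_pV2 ?posrE// ler_nat.
  have mF n : measurable (F n) by exact: measurable_itv.
  have mU : measurable (\bigcup_n F n) by exact: bigcup_measurable.
  have c1 := nondecreasing_cvg_mu (mu := m1) mF mU Fnd.
  have c2 := nondecreasing_cvg_mu (mu := m2) mF mU Fnd.
  have F12 : m1 \o F = m2 \o F.
    apply/funext => n; apply: m12; first by rewrite divr_gt0.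
    by rewrite ltr_pdivrMr// ltr_pMr// ltr1n.
  by rewrite FE -(cvg_lim _ c1)// -(cvg_lim _ c2)// F12.
suff : mrestr m1 mD A = mrestr m2 mD A by rewrite /mrestr setIidl.
have ocitvD u v : (`]u, v] `&` D = if (u < v) && (0 < v) then
    (if u <= 0 then `]0, v] else `]u, v]) else set0)%classic.
  apply/seteqP; split => x.
    rewrite /= !in_itv/= andbT => -[/andP[ux xv] x0].
    rewrite (lt_le_trans ux xv) (lt_le_trans x0 xv).
    by case: ifPn => _ /=; rewrite in_itv/= ?ux ?x0 xv.
  case: ifPn => // /andP[uv v0]; case: ifPn => u0 /=; rewrite !in_itv/= andbT.
    by move=> /andP[x0 ->]; rewrite (le_lt_trans u0 x0) x0.
  move=> /andP[ux ->]; rewrite ux; split => //.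
  by rewrite -ltNge in u0; exact: lt_trans ux.
have mrestrE (m : {measure set (measurableTypeR R) -> \bar R}) u v :
    mrestr m mD `]u, v]%classic = m (if (u < v) && (0 < v) then
    (if u <= 0 then `]0, v] else `]u, v]) else set0)%classic.
  exact: congr1 (ocitvD u v).
apply: (@measure_unique _ R (measurableTypeR R) (@ocitv R) (fun k => `](- k%:R), k%:R]%classic)
  _ _ _ _ (mrestr m1 mD) (mrestr m2 mD)) => //.
- exact: ocitvI.
- by move=> i; exact: is_ocitv.
- exact: (@bigcup_itvT R false false).
- move=> _ [[u v] _ <-]; apply: etrans (mrestrE m1 u v) _.
  apply: etrans _ (esym (mrestrE m2 u v)).
  case: ifPn => [/andP[uv v0]|]; last by rewrite !measure0.
  case: ifPn => u0; first exact: E0.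
  by rewrite m12// ltNge.
- move=> k; apply: (@eq_ind_r _ _ (fun x => x < +oo)%E _ _ (mrestrE m1 (- k%:R) k%:R)).
  case: ifPn => [/andP[_ k0]|]; last by rewrite measure0.
  by rewrite lerNl oppr0 ler0n m1oo.
Qed.

Lemma Rintegral_FTC (F f : R -> R) (u v : R) : u < v ->
  (forall x : R, u <= x <= v -> is_derive x 1 F (f x)) ->
  (forall x : R, u <= x <= v -> {for x, continuous f}) ->
  leb.-integrable `[u, v] (EFin \o f) /\
  \int[leb]_(x in `]u, v]) f x = F v - F u.
Proof.
move=> uv dF cf.
have wcf : {within `[u, v], continuous f}.
  apply: continuous_in_subspaceT => x /[!inE]; rewrite /= in_itv/=; exact: cf.
have If : leb.-integrable `[u, v] (EFin \o f).
  by apply: continuous_compact_integrable => //; exact: segment_compact.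
split => //; rewrite Rintegral_itv_obnd_cbnd; last first.
  by apply: integrableS If => //; exact: subset_itv_oc_cc.
have Fc (x : R) : u <= x <= v -> {for x, continuous F}.
  move=> xuv; apply/differentiable_continuous/derivable1_diffP.
  by apply: ex_derive; exact: dF.
rewrite /Rintegral (@continuous_FTC2 _ f F)//=.
- split.
  + move=> x; rewrite in_itv/= => /andP[/ltW ux /ltW xv].
    by apply: ex_derive; apply: dF; rewrite ux xv.
  + by apply: cvg_at_right_filter; apply: Fc; rewrite lexx ltW.
  + by apply: cvg_at_left_filter; apply: Fc; rewrite lexx ltW.
- move=> x; rewrite in_itv/= => /andP[/ltW ux /ltW xv].
  by rewrite derive1E; apply: derive_val; apply: dF; rewrite ux xv.
Qed.

(** This is ln z <= z at z = cx/q, multiplied by q. *)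
Lemma powR_le_expR (q c x : R) : 0 < q -> 0 < c -> 0 < x ->
  x `^ q <= (q / c) `^ q * expR (c * x).
Proof.
move=> q0 c0 x0; have qc0 : 0 < q / c by rewrite divr_gt0.
rewrite /powR !gt_eqF// -expRD ler_expR -lerBlDl -mulrBr -ln_div ?posrE//.
have -> : x / (q / c) = c / q * x by rewrite invf_div mulrC.
have -> : c * x = q * (c / q * x) by field; rewrite gt_eqF.
by rewrite ler_pM2l// ltW// ln_sublinear// mulr_gt0// divr_gt0.
Qed.

Lemma powRB1 (p x : R) : 0 < x -> x `^ (p - 1) = x `^ p / x.
Proof. by move=> x0; rewrite powRB ?(gt_eqF x0) ?implybT// powRr1// ltW. Qed.

Lemma measurable_powR_expR (p c : R) (A : set R) :
  measurable_fun A (fun x : R => x `^ (p - 1) * expR (- (c * x))).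
Proof.
apply/measurable_funTS/measurable_funM => //; apply: measurableT_comp => //.
by apply: measurableT_comp => //; exact: mulrl_measurable.
Qed.

Lemma integrable_expR (c : R) : 0 < c ->
  leb.-integrable D (EFin \o (fun x => expR (- (c * x)))).
Proof.
move=> c0;
have I := integrableS (@measurableT _ (measurableTypeR R)) mD (@subsetT _ _)
  (integrable_exponential_pdf c0).
apply: eq_integrable (integrable_EFinZ c^-1 mD I) => //.
move=> x /[!inE] /=; rewrite in_itv/= andbT => x0.
by rewrite exponential_pdfE ?ltW// mulNr mulKf ?gt_eqF.
Qed.

Lemma Rintegral_powR (p u v : R) : 0 < p -> 0 < u -> u < v ->
  leb.-integrable `[u, v] (EFin \o (fun x => x `^ (p - 1))) /\
  \int[leb]_(x in `]u, v]) x `^ (p - 1) = (v `^ p - u `^ p) / p.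
Proof.
move=> p0 u0 uv; rewrite mulrC mulrBr.
apply: (Rintegral_FTC (F := fun x => p^-1 * x `^ p)) => // x /andP[ux _];
  have x0 : 0 < x by exact: lt_le_trans ux.
- have := is_deriveZ p^-1 (is_derive1_powR p x0).
  by rewrite /= scalerA mulVf ?gt_eqF// scale1r.
- apply/differentiable_continuous/derivable1_diffP.
  by apply: ex_derive; exact: is_derive1_powR.
Qed.

(** The integrals over [1/(n+1), 1] are at most 1/p, whatever n, and they increase to the integral
    over ]0, 1]. *)
Lemma integrable_powR01 (p : R) : 0 < p ->
  leb.-integrable `]0, 1] (EFin \o (fun x => x `^ (p - 1))).
Proof.
move=> p0; have mp (A : set R) : measurable_fun A (fun x : R => x `^ (p - 1)).
  exact: measurable_funTS.
apply: ge0_integrable_EFin => //; [exact: mp|by move=> x _; exact: powR_ge0|].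
pose F n := `[(0 + n.+1%:R^-1 : R), 1]%classic.
have -> : `]0, 1]%classic = \bigcup_n F n by exact: (itv_open_bnd_bigcup false 1 0).
apply: (@le_lt_trans _ _ (p^-1%:E)); last exact: ltry.
have nF : nondecreasing_seq F.
  apply/nondecreasing_seqP => n; apply/subsetPset => x; rewrite /F/= !in_itv/=.
  by rewrite !add0r => /andP[nx ->]; rewrite andbT (le_trans _ nx)// lef_pV2 ?posrE// ler_nat.
have cF := @ge0_nondecreasing_set_cvg_integral _ (measurableTypeR R) R F
  (fun x => (x `^ (p - 1))%:E) leb nF.
apply: (cvge_le _ (cF _ _ _)); last 3 first.
- by move=> i; exact: measurable_itv.
- by move=> i; apply/measurable_EFinP; exact: mp.
- by move=> i x _; rewrite lee_fin powR_ge0.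
apply: nearW => n; rewrite /F add0r; set u := n.+1%:R^-1.
have u0 : 0 < u by rewrite invr_gt0.
have u1 : u <= 1 by rewrite invf_le1// ler1n.
(* For n = 0 the interval is the single point 1. *)
have [u1'|u1'] := ltP u 1; last first.
  have -> : u = 1 by apply/eqP; rewrite eq_le u1.
  by rewrite set_itv1 integral_set1 lee_fin invr_ge0 ltW.
have [If] := Rintegral_powR p0 u0 u1'.
rewrite Rintegral_itv_obnd_cbnd; last first.
  by apply: integrableS If => //; exact: subset_itv_oc_cc.
rewrite integrable_EFinE// lee_fin => ->.
by rewrite powR1 ler_pdivrMr// mulVf ?gt_eqF// gerBl powR_ge0.
Qed.

(** The power alone dominates on ]0, 1]. Beyond 1, half of the exponential rate absorbs x^p and the
    other half is integrable. *)
Lemma integrable_powR_expR (p c : R) : 0 < p -> 0 < c ->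
  leb.-integrable D (EFin \o (fun x => x `^ (p - 1) * expR (- (c * x)))).
Proof.
move=> p0 c0.
have I1 : leb.-integrable D (EFin \o ((fun x => x `^ (p - 1)) \_ `]0, 1])).
  have m01 : measurable (`]0, 1]%classic : set (measurableTypeR R)).
    exact: measurable_itv.
  have I01 := integrable_powR01 p0; rewrite -restrict_EFin.
  apply: (integrable_restrict leb m01 mD _).1; rewrite setIidr// => x.
  by rewrite /= !in_itv/= andbT => /andP[].
have c20 : 0 < c / 2 by rewrite divr_gt0.
have I2 := integrable_EFinZ ((p / (c / 2)) `^ p) mD
  (integrable_expR c20).
apply: (le_integrable_EFin mD _ _
  (integrable_EFinD mD I1 I2)); first exact: measurable_powR_expR.
move=> x /=; rewrite in_itv/= andbT => x0.
rewrite ger0_norm ?mulr_ge0 ?powR_ge0 ?expR_ge0// patchE.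
have e1 : expR (- (c * x)) <= 1 by rewrite expR_le1 oppr_le0 mulr_ge0// ltW.
case: ifPn => [_|].
  rewrite -[leLHS]addr0 lerD//; first by rewrite ler_piMr// powR_ge0.
  by rewrite mulr_ge0 ?powR_ge0 ?expR_ge0.
rewrite notin_setE/= in_itv/= x0/= => /negP; rewrite -ltNge => x1.
rewrite add0r (@le_trans _ _ (x `^ p * expR (- (c * x))))//.
  rewrite ler_wpM2r ?expR_ge0// powRB1// ler_piMr ?powR_ge0// invf_le1//.
  exact: ltW.
have -> : - (c * x) = - (c / 2 * x) + - (c / 2 * x) by field.
rewrite expRD mulrA ler_wpM2r ?expR_ge0//.
by rewrite expRN ler_pdivrMr ?expR_gt0// powR_le_expR.
Qed.

End real_line.

(** * The Mellin transform of the quantile kernel *)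

Lemma le_powR (R : realType) (r x y : R) : 0 <= r -> 0 <= x -> x <= y ->
  x `^ r <= y `^ r.
Proof.
by move=> r0 x0 xy; apply: ge0_ler_powR => //; rewrite nnegrE// (le_trans x0).
Qed.

(** The function H of the overview. At x = a it takes its upper value, in accordance with the closed
    interval in the second quantile inequality. *)
Definition qker (R : realType) (alpha a x : R) : R :=
  ((x <= a)%R%:R - alpha) * expR (- x).

Section gamma_quantile.
Context (R : realType).
Notation leb := (@lebesgue_measure R).
Notation D := (`]0, +oo[%classic : set R).
Variables alpha a : R.
Hypotheses (alpha_gt0 : 0 < alpha) (alpha_lt1 : alpha < 1) (a_gt0 : 0 < a).
Notation H := (qker alpha a).

Let mD : measurable (D : set (measurableTypeR R)).
Proof. exact: measurable_itv. Qed.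
Let mitv (i : interval R) : measurable ([set` i] : set (measurableTypeR R)).
Proof. exact: measurable_itv. Qed.

Lemma measurable_qker : measurable_fun setT H.
Proof.
have -> : H = (fun x => (\1_`]-oo, a] x - alpha) * expR (- x)).
  apply/funext => x; rewrite /qker indicE; congr (((nat_of_bool _)%:R - _) * _).
  by apply/idP/idP; rewrite inE/= in_itv.
apply: measurable_funM; last exact: measurableT_comp.
by apply: measurable_funB => //; apply: measurable_indic; exact: measurable_itv.
Qed.

Lemma qker_le x : x <= a -> H x = (1 - alpha) * expR (- x).
Proof. by move=> xa; rewrite /qker xa. Qed.

Lemma qker_gt x : a < x -> H x = - alpha * expR (- x).
Proof. by move=> xa; rewrite /qker leNgt xa/= sub0r. Qed.

Lemma norm_qker x : `|H x| <= expR (- x).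
Proof.
rewrite /qker normrM [`|expR _|]ger0_norm ?expR_ge0// ler_piMl ?expR_ge0//.
by case: (x <= a); rewrite ?sub0r ?normrN ger0_norm//= ?subr_ge0 ?gerBl ltW.
Qed.

Lemma Rintegral_cst_itv (u v c : R) : u < v ->
  leb.-integrable `]u, v] (EFin \o (fun=> c)) /\
  \int[leb]_(x in `]u, v]) c = c * (v - u).
Proof.
move=> uv; have luv : leb `]u, v]%classic = (v - u)%:E.
  by rewrite lebesgue_measure_itv/= lte_fin uv.
split; last by rewrite Rintegral_cst//; congr (_ * _); exact: (congr1 fine luv).
apply/integrableP; split; first exact: measurable_cst.
rewrite (eq_integral (cst `|c|%:E))// integral_cst; last exact: measurable_itv.
by rewrite [X in (_ * X)%E]luv ltry.
Qed.

(** The usual source of quantitative lower bounds below: of a nonnegative integrand only a box is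
    kept. *)
Lemma ge_cst_Rintegral A (f : R -> R) (u v c : R) :
  measurable (A : set (measurableTypeR R)) -> u < v -> `]u, v] `<=` A ->
  leb.-integrable A (EFin \o f) -> (forall x, A x -> 0 <= f x) ->
  (forall x, u < x <= v -> c <= f x) ->
  c * (v - u) <= \int[leb]_(x in A) f x.
Proof.
move=> mA uv uvA If f0 cf; have [Ic <-] := Rintegral_cst_itv c uv.
apply: (le_subset_Rintegral (mitv `]u, v]) mA uvA If Ic f0).
by move=> x /=; rewrite in_itv/=; exact: cf.
Qed.

Definition mellin (p : R) : R := \int[leb]_(x in D) (x `^ (p - 1) * H x).

Let powexp (p x : R) := x `^ (p - 1) * expR (- x).

Lemma integrable_powexp p : 0 < p -> leb.-integrable D (EFin \o powexp p).
Proof.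
move=> p0; have -> : powexp p = (fun x => x `^ (p - 1) * expR (- (1 * x))).
  by apply/funext => x; rewrite mul1r.
exact: integrable_powR_expR.
Qed.

Lemma measurable_powqker p (A : set R) : measurable_fun A (fun x => x `^ (p - 1) * H x).
Proof. by apply/measurable_funTS/measurable_funM => //; exact: measurable_qker. Qed.

Lemma integrable_mellin p : 0 < p ->
  leb.-integrable D (EFin \o (fun x => x `^ (p - 1) * H x)).
Proof.
move=> p0; apply: (le_integrable_EFin mD _ _ (integrable_powexp p0)).
  exact: measurable_powqker.
move=> x _; rewrite normrM ger0_norm ?powR_ge0// ler_wpM2l ?powR_ge0//.
exact: norm_qker.
Qed.

Let lowG p := \int[leb]_(x in `]0, a]) powexp p x.
Let uppG p := \int[leb]_(x in `]a, +oo[) powexp p x.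

Let subl : `]0, a] `<=` D.
Proof. by move=> x; rewrite /= !in_itv/= andbT => /andP[]. Qed.

Let subu : `]a, +oo[ `<=` D.
Proof. by move=> x; rewrite /= !in_itv/= !andbT; exact: lt_trans. Qed.

Let Il p : 0 < p -> leb.-integrable `]0, a] (EFin \o powexp p).
Proof. by move=> p0; exact: integrableS (integrable_powexp p0). Qed.

Let Iu p : 0 < p -> leb.-integrable `]a, +oo[ (EFin \o powexp p).
Proof. by move=> p0; exact: integrableS (integrable_powexp p0). Qed.

Lemma Rintegral_split_pos (c : R) (f : R -> R) : 0 < c ->
  leb.-integrable D (EFin \o f) ->
  \int[leb]_(x in D) f x =
  \int[leb]_(x in `]0, c]) f x + \int[leb]_(x in `]c, +oo[) f x.
Proof.
move=> c0; have DE : D = `]0, c] `|` `]c, +oo[.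
  by rewrite -itv_bndbnd_setU// bnd_simp// ltW.
move=> If; have := If; rewrite DE => IfU.
rewrite (Rintegral_setU (mitv `]0, c]) (mitv `]c, +oo[) IfU)//.
apply/disj_setPS => x /= [] /=; rewrite !in_itv/= andbT => /andP[_ xc] cx.
by move: (lt_le_trans cx xc); rewrite ltxx.
Qed.

Lemma mellinE p : 0 < p -> mellin p = (1 - alpha) * lowG p - alpha * uppG p.
Proof.
move=> p0; rewrite /mellin (Rintegral_split_pos a_gt0); last exact: integrable_mellin.
rewrite -mulNr -(RintegralZl _ (mitv _) (Il p0)) -(RintegralZl _ (mitv _) (Iu p0)).
congr (_ + _); apply: eq_Rintegral => x /[!inE]/=; rewrite in_itv/= ?andbT.
  by move=> /andP[_ xa]; rewrite qker_le// mulrCA.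
by move=> ax; rewrite qker_gt// mulrCA.
Qed.

Lemma Gamma_split (p : R) : 0 < p -> Gamma p = lowG p + uppG p.
Proof. by move=> p0; rewrite /Gamma; exact: (Rintegral_split_pos a_gt0 (integrable_powexp p0)). Qed.

(** Only ]2a, 3a] is kept. There the power x^n is at least 2^n a^n, while it is at most a^n on ]0,
    a]; this factor 2^n makes the Mellin transform negative for large n. *)
Let uppG_ge p n : p = n%:R + 1 -> expR (- (3 * a)) * (2 * a) ^+ n * a <= uppG p.
Proof.
move=> pn; have -> : expR (- (3 * a)) * (2 * a) ^+ n * a =
  expR (- (3 * a)) * (2 * a) ^+ n * (3 * a - 2 * a) by ring.
apply: ge_cst_Rintegral.
- exact: measurable_itv.
- by rewrite ltr_pM2r// ltr_nat.
- move=> x; rewrite /= !in_itv/= andbT => /andP[+ _]; apply: lt_trans.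
  by rewrite ltr_pMl// ltr1n.
- by apply: Iu; rewrite pn ltr_wpDl.
- by move=> x _; rewrite mulr_ge0 ?powR_ge0 ?expR_ge0.
- move=> x /andP[ax xa]; rewrite /powexp mulrC.
  have a2x : 0 <= 2 * a by rewrite mulr_ge0// ltW.
  apply: ler_pM; rewrite ?expR_ge0 ?exprn_ge0//.
    rewrite pn addrK powR_mulrn; last by rewrite (le_trans a2x)// ltW.
    by apply: lerXn2r; rewrite ?nnegrE// ?(le_trans a2x)// ltW.
  by rewrite ler_expR lerN2.
Qed.

Lemma Gamma_gt0 (p : R) : 0 < p -> 0 < Gamma p.
Proof.
move=> p0; apply: (@lt_le_trans _ _ (1 `^ p / 2 * expR (- 2) * (2 - 1))).
  by rewrite powR1 !mulr_gt0 ?expR_gt0// subr_gt0 ltr1n.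
apply: (ge_cst_Rintegral mD) => //.
- by rewrite ltr1n.
- by move=> x; rewrite /= !in_itv/= andbT => /andP[x1 _]; rewrite (lt_trans ltr01).
- exact: integrable_powexp.
- by move=> x _; rewrite mulr_ge0 ?powR_ge0 ?expR_ge0.
- move=> x /andP[x1 x2]; have x0 : 0 < x by exact: lt_trans x1.
  apply: ler_pM; rewrite ?expR_ge0 ?mulr_ge0 ?powR_ge0//.
    rewrite powRB1//; apply: ler_pM; rewrite ?powR_ge0//; last by rewrite lef_pV2 ?posrE.
    exact: (le_powR (ltW p0) ler01 (ltW x1)).
  by rewrite ler_expR lerN2.
Qed.

Lemma gamma_cdfE (p : R) : 0 < p -> gamma_cdf p a = (lowG p / Gamma p)%:E.
Proof.
move=> p0; rewrite /gamma_cdf /gamma_law.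
have -> : `]-oo, a] `&` `]0, +oo[ = `]0, a]%classic :> set R.
  apply/seteqP; split => x; rewrite /= !in_itv/= andbT; first by move=> [-> ->].
  by move=> /andP[-> ->].
transitivity ((Gamma p)^-1%:E * \int[leb]_(x in `]0%R, a]) (powexp p x)%:E)%E; last first.
  by rewrite (integrable_EFinE (mitv _) (Il p0)) -EFinM mulrC.
rewrite -(integralZl (mitv _) (Il p0)).
apply: eq_integral => x _; rewrite powR1 mul1r -EFinM /powexp mul1r.
by rewrite mulrA.
Qed.

(** Since H is exp(-x) times 1[x <= a] - alpha, the Mellin transform at p is Gamma(p) (E_p(a) -
    alpha). *)
Lemma gamma_cdf_mellin (p : R) : 0 < p -> gamma_cdf p a = alpha%:E <-> mellin p = 0.
Proof.
move=> p0; rewrite gamma_cdfE//; have G0 := Gamma_gt0 p0.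
have -> : mellin p = lowG p - alpha * Gamma p.
  by rewrite mellinE// Gamma_split//; ring.
split=> [[/(canRL (divfK (lt0r_neq0 G0)))->]|/eqP]; first by rewrite subrr.
by rewrite subr_eq0 => /eqP ->; rewrite mulfK ?gt_eqF.
Qed.

(** If both values vanish, so does the integral of (a^(q-p) - x^(q-p)) x^(p-1) H(x). Its first
    factor changes sign at a together with H, so the integrand is nonnegative, and it is bounded
    below by a positive constant on ]2a, 3a]. *)
Lemma mellin_inj p q : 0 < p -> p < q -> mellin p = 0 -> mellin q = 0 -> False.
Proof.
move=> p0 pq Mp Mq; have q0 := lt_trans p0 pq.
pose f x := a `^ (q - p) * (x `^ (p - 1) * H x) - x `^ (q - 1) * H x.
have If : leb.-integrable D (EFin \o f).
  apply: integrable_EFinB => //; last exact: integrable_mellin.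
  by apply: integrable_EFinZ => //; exact: integrable_mellin.
have f_int0 : \int[leb]_(x in D) f x = 0.
  rewrite /f RintegralB//; last 2 first.
  - by apply: integrable_EFinZ => //; exact: integrable_mellin.
  - exact: integrable_mellin.
  rewrite RintegralZl//; last exact: integrable_mellin.
  by rewrite -!/(mellin _) Mp Mq mulr0 subrr.
have fE (x : R) : 0 < x -> f x = (a `^ (q - p) - x `^ (q - p)) * (x `^ (p - 1) * H x).
  move=> x0; rewrite /f mulrBl; congr (_ - _).
  rewrite [RHS]mulrA -powRD; last by rewrite (gt_eqF x0) implybT.
  by congr (_ `^ _ * _); ring.
have qp0 : 0 < q - p by rewrite subr_gt0.
have f0 (x : R) : D x -> 0 <= f x.
  rewrite /= in_itv/= andbT => x0; rewrite fE//; have [xa|ax] := leP x a.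
    rewrite mulr_ge0// ?subr_ge0.
      exact: (le_powR (ltW qp0) (ltW x0) xa).
    by rewrite mulr_ge0 ?powR_ge0// qker_le// mulr_ge0 ?expR_ge0// subr_ge0 ltW.
  rewrite mulr_le0// ?subr_le0.
    exact: (le_powR (ltW qp0) (ltW a_gt0) (ltW ax)).
  rewrite mulr_ge0_le0 ?powR_ge0// qker_gt// mulNr oppr_le0 mulr_ge0 ?expR_ge0//.
  exact: ltW.
pose c := ((2 * a) `^ (q - p) - a `^ (q - p)) *
  ((2 * a) `^ p / (3 * a) * (alpha * expR (- (3 * a)))).
have a2 : a < 2 * a by rewrite ltr_pMl// ltr1n.
have a20 : 0 < 2 * a by exact: lt_trans a2.
have a30 : 0 < 3 * a by rewrite mulr_gt0.
have c0 : 0 < c.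
  rewrite mulr_gt0// ?subr_gt0; first by rewrite gt0_ltr_powR ?nnegrE ?ltW.
  by rewrite !mulr_gt0 ?powR_gt0 ?invr_gt0// expR_gt0.
have a23 : 2 * a < 3 * a by rewrite ltr_pM2r// ltr_nat.
suff : c * (3 * a - 2 * a) <= \int[leb]_(x in D) f x.
  by rewrite f_int0 leNgt mulr_gt0// subr_gt0.
apply: (ge_cst_Rintegral mD) => //.
  by move=> x; rewrite /= !in_itv/= andbT => /andP[ax _]; exact: lt_trans ax.
move=> x /andP[ax xa]; have x0 : 0 < x by exact: lt_trans ax.
rewrite fE// qker_gt ?(lt_trans a2)//.
have -> : (a `^ (q - p) - x `^ (q - p)) * (x `^ (p - 1) * (- alpha * expR (- x))) =
  (x `^ (q - p) - a `^ (q - p)) * (x `^ (p - 1) * (alpha * expR (- x))) by ring.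
apply: ler_pM.
- by rewrite subr_ge0; exact: (le_powR (ltW qp0) (ltW a_gt0) (ltW a2)).
- by rewrite !mulr_ge0 ?powR_ge0 ?invr_ge0 ?expR_ge0// ltW.
- by rewrite lerD2r; exact: (le_powR (ltW qp0) (ltW a20) (ltW ax)).
apply: ler_pM.
- by rewrite mulr_ge0 ?powR_ge0 ?invr_ge0// ltW.
- by rewrite mulr_ge0 ?expR_ge0// ltW.
- rewrite powRB1//; apply: ler_pM; rewrite ?powR_ge0 ?invr_ge0//; first exact: ltW.
    exact: (le_powR (ltW p0) (ltW a20) (ltW ax)).
  by rewrite lef_pV2 ?posrE.
- by rewrite ler_pM2l// ler_expR lerN2.
Qed.

(** For exponents between p/2 and p+1 the integrand is dominated by the one at p/2 when x <= 1 and
    by the one at p+1 when x > 1; the sum of the two serves for all x. *)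
Lemma continuous_mellin p : 0 < p -> {for p, continuous mellin}.
Proof.
move=> p0; have p20 : 0 < p / 2 by rewrite divr_gt0.
have p10 : 0 < p + 1 by rewrite addr_gt0.
have sub l : (`]p / 2, p + 1[%classic : set R) l -> (p / 2 < l) /\ (l < p + 1).
  by rewrite /= in_itv/= => /andP[].
apply: (@continuity_under_integral R _ _ leb (fun l x => x `^ (l - 1) * H x) D mD
  (p / 2) (p + 1) _ _ (fun x => powexp (p / 2) x + powexp (p + 1) x)).
- by move=> l /sub[pl _]; apply: integrable_mellin; exact: lt_trans pl.
- apply: aeW => y; rewrite /= in_itv/= andbT => y0 l _.
  have -> : (fun l => y `^ (l - 1) * H y) = (fun l => expR ((l - 1) * ln y) * H y).
    by apply/funext => z; rewrite /powR gt_eqF.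
  have c1 : {for l, continuous (fun z : R => (z - 1) * ln y)}.
    by apply: cvgM; [apply: cvgB; [exact: cvg_id|exact: cvg_cst]|exact: cvg_cst].
  have c2 := continuous_comp c1 (@continuous_expR R _).
  exact: (cvgM c2 (cvg_cst _)).
- by apply: integrable_EFinD => //; exact: integrable_powexp.
- move=> l /sub[pl lp]; apply: aeW => y; rewrite /= in_itv/= andbT => y0.
  rewrite normrM ger0_norm ?powR_ge0// (@le_trans _ _ (y `^ (l - 1) * expR (- y)))//.
    by rewrite ler_wpM2l ?powR_ge0 ?norm_qker.
  rewrite /powexp -mulrDl ler_wpM2r ?expR_ge0//; have [y1|y1] := leP y 1.
    rewrite -[leLHS]addr0 lerD ?powR_ge0//; apply: ger_powR; first by rewrite y0.
    by rewrite lerD2r ltW.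
  rewrite -[leLHS]add0r lerD ?powR_ge0//; apply: ler_powR; first exact: ltW.
  by rewrite lerD2r ltW.
- by rewrite inE/= in_itv/= ltr_pdivrMr// ltr_pMr// ltr1n ltrDl ltr01.
Qed.

(** As p decreases to 0, the mass near the origin grows like 1/p, while the part beyond a stays
    bounded. *)
Lemma mellin_gt0 : exists p, [/\ 0 < p, p <= 1 & 0 < mellin p].
Proof.
pose E := \int[leb]_(x in `]a, +oo[) expR (- x).
have IE : leb.-integrable `]a, +oo[ (EFin \o (fun x => expR (- x))).
  apply: (integrableS mD (mitv _) subu); have := integrable_expR (@ltr01 R).
  by apply: eq_integrable => // x _; rewrite /= mul1r.
have E0 : 0 <= E by apply: Rintegral_ge0 => x _; exact: expR_ge0.
pose k := (1 - alpha) * expR (- a) * a.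
have k0 : 0 < k by rewrite !mulr_gt0 ?expR_gt0// subr_gt0.
pose m := 2 * alpha * E.
have m0 : 0 <= m by rewrite !mulr_ge0// ltW.
(* After division by the common factor a^p / (2ap), the final comparison reads p m < k. The bound p
   <= 1 makes x^(p-1) decreasing, which controls the tail; the summand 1 covers m = 0. *)
pose p := Num.min 1 (k / (m + 1)).
have p0 : 0 < p by rewrite lt_min ltr01 divr_gt0// ltr_wpDl.
have p1 : p <= 1 by rewrite ge_min lexx.
have pk : p * m < k.
  have : p <= k / (m + 1) by rewrite ge_min lexx orbT.
  rewrite ler_pdivlMr ?ltr_wpDl//; apply: lt_le_trans.
  by rewrite ltr_pM2l// ltrDl.
exists p; split => //; rewrite mellinE// subr_gt0.
have ap0 := powR_gt0 p a_gt0.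
have T_le : uppG p <= a `^ p / a * E.
  rewrite -RintegralZl//; apply: le_Rintegral => //; first exact: Iu.
    exact: integrable_EFinZ.
  move=> x; rewrite /= in_itv/= andbT => ax; have x0 : 0 < x by exact: lt_trans ax.
  rewrite ler_wpM2r ?expR_ge0// -powRB1// -!(opprB 1) !powRN.
  rewrite lef_pV2 ?posrE ?powR_gt0//; apply: le_powR; rewrite ?subr_ge0// ltW//.
(* The point where w^p is half of a^p: x^(p-1) has integral a^p / (2p) over ]w, a], which stays away
   from the singularity at 0. *)
pose w := 2^-1 `^ p^-1 * a.
have w0 : 0 < w by rewrite mulr_gt0// powR_gt0 invr_gt0.
have wp : w `^ p = a `^ p / 2.
  rewrite powRM ?powR_ge0// ?ltW// -powRrM mulVf ?gt_eqF// powRr1 ?invr_ge0//.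
  by rewrite mulrC.
have wa : w < a.
  rewrite gtr_pMl//; have : 2^-1 `^ p^-1 < (1 : R) `^ p^-1.
    by apply: gt0_ltr_powR; rewrite ?invr_gt0 ?nnegrE ?invr_ge0// invf_lt1// ltr1n.
  by rewrite powR1.
have B_ge : expR (- a) * (a `^ p / 2 / p) <= lowG p.
  have [Iw] := Rintegral_powR p0 w0 wa.
  have {}Iw : leb.-integrable `]w, a] (EFin \o (fun x => x `^ (p - 1))).
    by apply: integrableS Iw => //; exact: subset_itv_oc_cc.
  have -> : a `^ p - w `^ p = a `^ p / 2 by rewrite wp; field.
  move=> <-; rewrite -RintegralZl//; apply: le_subset_Rintegral => //.
  - by move=> x; rewrite /= !in_itv/= => /andP[wx ->]; rewrite (lt_trans w0 wx).
  - exact: Il.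
  - exact: integrable_EFinZ.
  - by move=> x _; rewrite mulr_ge0 ?powR_ge0 ?expR_ge0.
  - move=> x; rewrite /= in_itv/= => /andP[_ xa].
    by rewrite mulrC ler_wpM2l ?powR_ge0// ler_expR lerN2.
apply: (@le_lt_trans _ _ (alpha * (a `^ p / a * E))); first by rewrite ler_pM2l.
apply: (@lt_le_trans _ _ ((1 - alpha) * (expR (- a) * (a `^ p / 2 / p)))); last first.
  by rewrite ler_pM2l// subr_gt0.
have -> : alpha * (a `^ p / a * E) = (a `^ p / (2 * a * p)) * (p * m).
  by rewrite /m; field; rewrite !gt_eqF.
have -> : (1 - alpha) * (expR (- a) * (a `^ p / 2 / p)) = (a `^ p / (2 * a * p)) * k.
  by rewrite /k; field; rewrite !gt_eqF.
by rewrite ltr_pM2l// divr_gt0// !mulr_gt0.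
Qed.

Lemma mellin_lt0 : exists p, 1 < p /\ mellin p < 0.
Proof.
(* 2^n > K is exactly what the bound on ]2a, 3a] needs in order to beat the part up to a, which is
   at most (1 - alpha) a^n a. *)
pose K := (1 - alpha) / (alpha * expR (- (3 * a))).
pose n := (Num.truncn K).+1; pose p : R := n%:R + 1.
have aE0 : 0 < alpha * expR (- (3 * a)) by rewrite mulr_gt0 ?expR_gt0.
have K2n : K < 2 ^+ n.
  by rewrite (lt_le_trans (truncnS_gt _))// -natrX ler_nat ltnW// ltn_expl.
have p1 : 1 < p by rewrite ltrDr ltr0n.
have p0 : 0 < p by exact: lt_trans p1.
exists p; split => //; rewrite mellinE// subr_lt0.
have B_le : lowG p <= a ^+ n * a.
  have [Ic Ec] := Rintegral_cst_itv (a ^+ n) a_gt0.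
  rewrite -[X in _ <= _ * X]subr0 -Ec; apply: le_Rintegral => //; first exact: Il.
  move=> x; rewrite /= in_itv/= => /andP[x0 xa].
  rewrite -[leRHS]mulr1; apply: ler_pM; rewrite ?powR_ge0 ?expR_ge0//.
    rewrite addrK powR_mulrn; last exact: ltW.
    by apply: lerXn2r; rewrite ?nnegrE// ltW.
  by rewrite expR_le1 oppr_le0 ltW.
have T_ge := uppG_ge (erefl p).
apply: (@le_lt_trans _ _ ((1 - alpha) * (a ^+ n * a))).
  by rewrite ler_pM2l// subr_gt0.
apply: (@lt_le_trans _ _ (alpha * (expR (- (3 * a)) * (2 * a) ^+ n * a))); last first.
  by rewrite ler_pM2l.
have -> : alpha * (expR (- (3 * a)) * (2 * a) ^+ n * a) =
  (alpha * expR (- (3 * a)) * 2 ^+ n) * (a ^+ n * a) by rewrite exprMn; ring.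
rewrite ltr_pM2r; last by rewrite mulr_gt0// exprn_gt0.
by rewrite mulrC -ltr_pdivrMr.
Qed.

Lemma mellin_root : exists2 p, 0 < p & mellin p = 0.
Proof.
have [u [u0 u1 Mu]] := mellin_gt0; have [v [v1 Mv]] := mellin_lt0.
have uv : u <= v by rewrite (le_trans u1)// ltW.
have [||p] := @IVT _ mellin u v 0 uv.
- apply: continuous_in_subspaceT => x /[!inE]; rewrite /= in_itv/= => /andP[ux _].
  by apply: continuous_mellin; exact: lt_le_trans ux.
- by rewrite ge_min le_max (ltW Mu) (ltW Mv) orbT.
- by rewrite in_itv/= => /andP[up _] Mp; exists p => //; exact: lt_le_trans up.
Qed.

End gamma_quantile.

(** * The density equation *)

(** Writing 1/x as x (x^2)^(-1) leaves a real power of a nonnegative number; at 0 both sides are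
    0. *)
Lemma measurable_inv (R : realType) : measurable_fun setT (fun x : R => x^-1).
Proof.
have -> : (fun x : R => x^-1) = (fun x => x * (x ^+ 2) `^ (-1)).
  apply/funext => x; have [->|x0] := eqVneq x 0; first by rewrite invr0 mul0r.
  by rewrite powR_inv1 ?sqr_ge0// expr2 invfM mulrA divff// mul1r.
apply: measurable_funM => //.
exact: (measurableT_comp (measurable_powR (-1)) (@exprn_measurable R setT 2)).
Qed.

Lemma Rintegral_expR_inv (R : realType) (k u v : R) : 0 < u -> u < v ->
  (@lebesgue_measure R).-integrable `[u, v]
    (EFin \o (fun r => k / r ^+ 2 * expR (- (k / r)))) /\
  \int[@lebesgue_measure R]_(r in `]u, v]) (k / r ^+ 2 * expR (- (k / r))) =
  expR (- (k / v)) - expR (- (k / u)).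
Proof.
move=> u0 uv.
apply: (Rintegral_FTC (F := fun r => expR (- (k / r)))
  (f := fun r => k / r ^+ 2 * expR (- (k / r)))) => // r /andP[ur _];
  have r0 : r != 0 by rewrite gt_eqF// (lt_le_trans u0).
- have d1 := is_deriveZ (- k) (is_deriveV r0 (is_derive_id r 1)).
  have -> : (fun r => expR (- (k / r))) = expR \o (- k \*: (fun r => r^-1)).
    by apply/funext => x; rewrite /= /GRing.scale/= mulNr.
  apply: is_derive_eq (is_derive1_comp (is_derive_expR _) d1) _.
  rewrite /= /GRing.scale/= mulNr mulrC; congr (_ * _).
  by rewrite mulr1 mulrNN.
- have c1 : {for r, continuous (fun r : R => r^-1)} by exact: inv_continuous.
  apply: cvgM.
    apply: cvgM; first exact: cvg_cst.
    by apply: cvgV; [rewrite expf_neq0|exact: exprn_continuous].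
  have c2 : {for r, continuous (fun r : R => - (k / r))}.
    by apply: cvgN; apply: cvgM; [exact: cvg_cst|exact: c1].
  exact: (continuous_comp c2 (@continuous_expR R _)).
Qed.

Section balanced.
Context (R : realType).
Notation leb := (@lebesgue_measure R).
Notation D := (`]0, +oo[%classic : set R).
Variables alpha a : R.
Hypotheses (alpha_gt0 : 0 < alpha) (alpha_lt1 : alpha < 1) (a_gt0 : 0 < a).
Notation H := (qker alpha a).

Let mD : measurable (D : set (measurableTypeR R)).
Proof. exact: measurable_itv. Qed.

Let mitv (i : interval R) : measurable ([set` i] : set (measurableTypeR R)).
Proof. exact: measurable_itv. Qed.

Let kle (y r : R) : 0 < r -> (a * y / r <= a) = (y <= r).
Proof. by move=> r0; rewrite ler_pdivrMr// ler_pM2l. Qed.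

(** In the variable r the integrand is the derivative of H(ay/r) away from r = y. There the
    indicator in H switches on, H(ay/r) jumps up by exp(-a), and the last term takes this jump away
    from the increment. *)
Lemma Rintegral_qker_inv (y u v : R) : 0 < u -> u < v ->
  \int[leb]_(r in `]u, v]) (a * y / r ^+ 2 * H (a * y / r)) =
  H (a * y / v) - H (a * y / u) - expR (- a) * \1_(`]u, v]%classic) y.
Proof.
move=> u0 uv; have v0 := lt_trans u0 uv.
pose E r := expR (- (a * y / r)); pose phi r := a * y / r ^+ 2 * E r.
have FTC s t : 0 < s -> s < t -> leb.-integrable `]s, t] (EFin \o phi) /\
    \int[leb]_(r in `]s, t]) phi r = E t - E s.
  move=> s0 st; have [I1 ->] := Rintegral_expR_inv (a * y) s0 st; split=> //.
  by apply: integrableS I1 => //; exact: subset_itv_oc_cc.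
have [Iphi phiE] := FTC _ _ u0 uv.
have Ipatch : leb.-integrable `]u, v] (EFin \o (phi \_ `[y, +oo[)).
  rewrite -restrict_EFin; apply: (integrable_restrict leb (mitv `[y, +oo[) (mitv `]u, v]) _).1.
  by apply: integrableS Iphi => //; exact: measurableI.
have key : \int[leb]_(r in `]u, v]) (phi \_ `[y, +oo[) r =
    (y <= v)%R%:R * E v - (y <= u)%R%:R * E u - expR (- a) * \1_(`]u, v]%classic) y.
  rewrite -Rintegral_mkcondr; have [yu|uy] := leP y u.
    rewrite (le_trans yu (ltW uv)) indicE memNset ?mulr0 ?subr0 ?mul1r; last first.
      by rewrite /= in_itv/= ltNge yu.
    rewrite setIidl// => x; rewrite /= !in_itv/= andbT => /andP[ux _].
    by rewrite ltW// (le_lt_trans yu).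
  have y0 := lt_trans u0 uy.
  rewrite mul0r subr0; have [yv|vy] := leP y v; last first.
    rewrite mul0r indicE memNset ?mulr0 ?subr0; last first.
      by rewrite /= in_itv/= uy/= leNgt vy.
    rewrite (_ : _ `&` _ = set0) ?Rintegral_set0// -subset0 => x [/=].
    rewrite !in_itv/= andbT => /andP[_ xv] yx.
    by move: (le_trans yx xv); rewrite leNgt vy.
  rewrite mul1r indicE mem_set ?mulr1; last by rewrite /= in_itv/= uy.
  have -> : `]u, v] `&` `[y, +oo[ = `[y, v]%classic :> set R.
    apply/seteqP; split => x; rewrite /= !in_itv/= andbT.
      by move=> [/andP[_ ->] ->].
    by move=> /andP[yx xv]; rewrite yx xv (lt_le_trans uy yx).
  have Ey : expR (- a) = E y by rewrite /E mulfK// gt_eqF.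
  move: yv; rewrite le_eqVlt => /predU1P[<-|yv].
    by rewrite set_itv1 Rintegral_set1 Ey subrr.
  have [I2 E2] := FTC _ _ y0 yv.
  by rewrite -Rintegral_itv_obnd_cbnd// E2 Ey.
transitivity (\int[leb]_(r in `]u, v]) ((phi \_ `[y, +oo[) r - alpha * phi r)).
  apply: eq_Rintegral => r /[!inE]; rewrite /= in_itv/= => /andP[ur _].
  have r0 := lt_trans u0 ur.
  rewrite /qker kle// patchE; case: ifPn => [|/negP]; rewrite inE/= in_itv/= andbT.
    by move=> ->; rewrite mulrBl mul1r mulrBr (mulrCA _ alpha).
  by move=> /negP/negbTE ->; rewrite !sub0r mulNr mulrN mulrCA.
rewrite RintegralB//; last exact: integrable_EFinZ.
rewrite key RintegralZl// phiE /qker !kle// -/(E u) -/(E v); ring.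
Qed.

(** The weight lets one set of lemmas serve both Q itself, with w = 1, and densities against
    Lebesgue measure. The sign of w is left free here, so differences of solutions are covered as
    well. *)
Definition balanced (mu : {measure set (measurableTypeR R) -> \bar R}) (w : R -> R) : Prop :=
  [/\ measurable_fun setT w,
      forall t, 0 < t -> mu.-integrable D (EFin \o (fun y => expR (- (t * y)) * w y)) &
      forall t, 0 < t -> \int[mu]_(y in D) (H (t * y) * w y) = 0].

Section weight.
Variables (mu : {sigma_finite_measure set (measurableTypeR R) -> \bar R}) (w : R -> R).
Hypothesis bw : balanced mu w.

Let mw : measurable_fun setT w. Proof. by case: bw. Qed.

Let Iew t : 0 < t -> mu.-integrable D (EFin \o (fun y => expR (- (t * y)) * w y)).
Proof. by case: bw => _ + _; exact. Qed.

Lemma balanced_integrable (f : R -> R) (C c : R) : measurable_fun setT f ->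
  0 < c -> (forall y, 0 < y -> `|f y| <= C * expR (- (c * y))) ->
  mu.-integrable D (EFin \o (fun y => f y * w y)).
Proof.
move=> mf c0 fC; have Ic := integrable_EFinZ C mD (integrable_norm (Iew c0)).
apply: (le_integrable_EFin mD _ _ Ic).
  by apply/measurable_funTS/measurable_funM.
move=> y; rewrite /= in_itv/= andbT => y0.
by rewrite !normrM [`|expR _|]ger0_norm ?expR_ge0// mulrA ler_wpM2r// fC.
Qed.

(** The function Z of the overview, for the measure w mu. At s = a/r its kernel vanishes for y =
    r. *)
Definition density_factor (s : R) : R :=
  \int[mu]_(y in D) ((a - s * y) * H (s * y) * w y).

Let mH : measurable_fun setT H. Proof. exact: measurable_qker. Qed.

Lemma mulr_expRN_le (x : R) : 0 <= x -> x * expR (- x) <= 2 * expR (- (x / 2)).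
Proof.
move=> x0; have -> : - x = - (x / 2) + - (x / 2) by field.
rewrite expRD mulrA ler_wpM2r ?expR_ge0// expRN ler_pdivrMr ?expR_gt0//.
rewrite -ler_pdivrMl// mulrC (le_trans _ (expR_ge1Dx _))//.
by rewrite lerDr ler01.
Qed.

Lemma measurable_kernel : measurable_fun setT (fun x : R => (a - x) * H x).
Proof. by apply: measurable_funM => //; exact: measurable_funB. Qed.

(** Both factors change sign at a. *)
Lemma kernel_ge0 (x : R) : 0 <= (a - x) * H x.
Proof.
have [xa|ax] := leP x a.
  by rewrite qker_le// mulr_ge0 ?subr_ge0// mulr_ge0 ?expR_ge0// subr_ge0 ltW.
rewrite qker_gt// mulr_le0 ?subr_le0 ?ltW// mulNr oppr_lt0.
by rewrite mulr_gt0 ?expR_gt0.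
Qed.

Lemma norm_kernel_le (x : R) : 0 <= x -> `|(a - x) * H x| <= (a + 2) * expR (- (x / 2)).
Proof.
move=> x0; rewrite normrM (@le_trans _ _ ((a + x) * expR (- x)))//.
  apply: ler_pM => //; last exact: norm_qker.
  by rewrite (le_trans (ler_normB _ _))// !ger0_norm// ltW.
rewrite mulrDl [leRHS]mulrDl lerD//; last exact: mulr_expRN_le.
rewrite ler_wpM2l//; first exact: ltW.
by rewrite ler_expR lerN2 ler_piMr// invf_le1// ler1n.
Qed.

Lemma integrable_kernel s : 0 < s ->
  mu.-integrable D (EFin \o (fun y => (a - s * y) * H (s * y) * w y)).
Proof.
move=> s0; apply: (@balanced_integrable _ (a + 2) (s / 2)).
- by apply: (measurableT_comp measurable_kernel); exact: mulrl_measurable.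
- by rewrite divr_gt0.
- move=> y y0; rewrite (le_trans (norm_kernel_le _))//; first by rewrite mulr_ge0// ltW.
  by rewrite mulrAC.
Qed.

Lemma measurable_density_factor : measurable_fun setT density_factor.
Proof.
apply: (@measurable_Rintegral2 _ _ _ _ R mu D
  (fun z : measurableTypeR R * measurableTypeR R =>
    (a - z.1 * z.2) * H (z.1 * z.2) * w z.2)) => //.
have m12 : measurable_fun setT (fun z : measurableTypeR R * measurableTypeR R => z.1 * z.2 : R).
  exact: measurable_funM.
apply: measurable_funM; last exact: measurableT_comp.
exact: (measurableT_comp measurable_kernel m12).
Qed.

(** When the jump formula is integrated against w, balance removes the two boundary terms and only
    the jump remains. The minus sign in [f] makes that jump count positively. *)
Lemma balanced_density (u v : R) : 0 < u -> u < v ->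
  expR (- a) * \int[mu]_(y in `]u, v]) w y =
  \int[leb]_(r in `]u, v]) (density_factor (a / r) / r).
Proof.
move=> u0 uv; have v0 := lt_trans u0 uv.
have uvD : `]u, v] `<=` D.
  by move=> y; rewrite /= !in_itv/= andbT => /andP[uy _]; exact: lt_trans uy.
have IH t : 0 < t -> mu.-integrable D (EFin \o (fun y => H (t * y) * w y)).
  move=> t0; apply: (@balanced_integrable _ 1 t) => //.
    by apply: measurableT_comp => //; exact: mulrl_measurable.
  by move=> y _; rewrite mul1r norm_qker.
have HI t : 0 < t -> \int[mu]_(y in D) (H (t * y) * w y) = 0 by case: bw => _ _; exact.
have Iw : mu.-integrable D (EFin \o (fun y => \1_(`]u, v]%classic) y * w y)).
  apply: (@balanced_integrable _ (expR v) 1) => //.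
  move=> y y0; rewrite indicE mul1r -expRD; have [|_] := boolP (y \in _).
    rewrite inE/= in_itv/= => /andP[_ yv] /=; rewrite normr1 -expR0 ler_expR.
    by rewrite subr_ge0.
  by rewrite normr0 expR_ge0.
pose f (z : measurableTypeR R * measurableTypeR R) :=
  - w z.1 * (a * z.1 / z.2 ^+ 2 * H (a * z.1 / z.2)).
have mf : measurable_fun setT f.
  have m2 : measurable_fun setT (fun z : measurableTypeR R * measurableTypeR R => z.2^-1 : R).
    exact: (measurableT_comp (@measurable_inv R)).
  have m1 : measurable_fun setT (fun z : measurableTypeR R * measurableTypeR R => a * z.1 : R).
    exact: measurable_funM.
  apply: measurable_funM.
    by apply: measurable_funN; exact: (measurableT_comp mw).
  apply: measurable_funM.
    apply: measurable_funM => //; apply: (measurableT_comp (@measurable_inv R)).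
    exact: measurable_funX.
  by apply: measurableT_comp => //; exact: measurable_funM.
(* For r <= v the argument x = ay/r is at least ay/v. Half of this rate is spent on absorbing the
   factor x. *)
have c0 : 0 < a / v / 2 by rewrite !divr_gt0.
have [Ih _] := Rintegral_cst_itv (2 / u) uv.
have fbound y r : D y -> (`]u, v]%classic : set R) r ->
    `|f (y, r)| <= `|expR (- (a / v / 2 * y)) * w y| * (2 / u).
  rewrite /= !in_itv/= andbT => y0 /andP[ur rv]; have r0 := lt_trans u0 ur.
  pose x := a * y / r; have x0 : 0 <= x by rewrite ltW// divr_gt0// mulr_gt0.
  have -> : `|f (y, r)| = `|w y| * (x / r * `|H x|).
    rewrite /f/= -/x normrM normrN [X in _ * X]normrM; congr (_ * (_ * _)).
    have -> : a * y / r ^+ 2 = x / r by rewrite /x; field; rewrite gt_eqF.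
    by rewrite ger0_norm// divr_ge0// ltW.
  have -> : `|expR (- (a / v / 2 * y)) * w y| * (2 / u) =
      `|w y| * (expR (- (a / v / 2 * y)) * (2 / u)).
    by rewrite normrM ger0_norm ?expR_ge0//; ring.
  rewrite ler_wpM2l//.
  have -> : x / r * `|H x| = (x * `|H x|) * r^-1 by rewrite mulrAC.
  rewrite [leRHS]mulrA; apply: ler_pM.
  - by apply: mulr_ge0.
  - by rewrite invr_ge0 ltW.
  - apply: (@le_trans _ _ (x * expR (- x))).
      by apply: ler_wpM2l => //; exact: norm_qker.
    rewrite (le_trans (mulr_expRN_le x0))// mulrC ler_wpM2r// ler_expR lerN2.
    have -> : a / v / 2 * y = a * y / v / 2 by field; rewrite gt_eqF.
    by rewrite /x ler_pM2r ?invr_gt0// ler_pM2l ?mulr_gt0// lef_pV2 ?posrE.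
  - by rewrite lef_pV2 ?posrE// ltW.
have := @Fubini_dominated _ _ _ _ R mu leb D `]u, v] f
  (fun y => `|expR (- (a / v / 2 * y)) * w y|) (fun=> 2 / u)
  mD (mitv _) mf (integrable_norm (Iew c0)) Ih fbound.
have -> : \int[mu]_(y in D) \int[leb]_(r in `]u, v]) f (y, r) =
    expR (- a) * \int[mu]_(y in `]u, v]) w y.
  transitivity (\int[mu]_(y in D) (H (a / u * y) * w y - H (a / v * y) * w y +
      expR (- a) * (\1_(`]u, v]%classic) y * w y))).
    apply: eq_Rintegral => y; rewrite inE/= in_itv/= andbT => y0.
    rewrite /f/= RintegralZl//; last first.
      have [Ic _] := Rintegral_cst_itv (a * y / u ^+ 2) uv.
      apply: (le_integrable_EFin (mitv _) _ _ Ic).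
        apply/measurable_funTS/measurable_funM.
          apply: measurable_funM => //; apply: (measurableT_comp (@measurable_inv R)).
          exact: exprn_measurable.
        apply: measurableT_comp => //; apply: measurable_funM => //.
        exact: measurable_inv.
      move=> r; rewrite /= in_itv/= => /andP[ur _]; have r0 := lt_trans u0 ur.
      have ay0 : 0 < a * y by rewrite mulr_gt0.
      rewrite normrM -[leRHS]mulr1; apply: ler_pM => //.
        have p0 : 0 <= a * y / r ^+ 2 by rewrite divr_ge0 ?sqr_ge0// ltW.
        rewrite ger0_norm// ler_pM2l// lef_pV2 ?posrE ?exprn_gt0//.
        by apply: lerXn2r; rewrite ?nnegrE ltW.
      rewrite (le_trans (norm_qker _ alpha_gt0 alpha_lt1 _))// expR_le1 oppr_le0.
      by rewrite divr_ge0// ltW.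
    rewrite Rintegral_qker_inv// ![a / _ * _]mulrAC; ring.
  rewrite RintegralD//; last 2 first.
  - by apply: integrable_EFinB => //; apply: IH; rewrite divr_gt0.
  - exact: integrable_EFinZ.
  rewrite RintegralB//; [|by apply: IH; rewrite divr_gt0..].
  rewrite !HI ?divr_gt0// subrr add0r RintegralZl//; congr (_ * _).
  rewrite -[in RHS](setIidr uvD) Rintegral_mkcondr; apply: eq_Rintegral => y _.
  by rewrite patchE indicE; case: ifPn; rewrite ?mul1r ?mul0r.
move=> ->; apply: eq_Rintegral => r; rewrite inE/= in_itv/= => /andP[ur _].
have r0 := lt_trans u0 ur; have ar0 : 0 < a / r by rewrite divr_gt0.
(* Adding and subtracting (a/r) H(ay/r), whose integral vanishes by balance, turns the signed kernel
   -x H(x) into (a - x) H(x). *)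
transitivity (\int[mu]_(y in D) (r^-1 * ((a - a / r * y) * H (a / r * y) * w y) -
    a / r * (H (a / r * y) * w y))).
  apply: eq_Rintegral => y _; rewrite /f/= [a * y / r]mulrAC; field.
  by rewrite gt_eqF.
rewrite RintegralB//; last 2 first.
- by apply: integrable_EFinZ => //; exact: integrable_kernel.
- by apply: integrable_EFinZ => //; exact: IH.
rewrite !RintegralZl//; [|exact: integrable_kernel|exact: IH].
by rewrite HI// mulr0 subr0 mulrC.
Qed.

End weight.
End balanced.

(** * The primitive of the kernel *)

Section primitive.
Context (R : realType).
Notation leb := (@lebesgue_measure R).
Notation D := (`]0, +oo[%classic : set R).
Variables alpha a : R.
Hypotheses (alpha_gt0 : 0 < alpha) (alpha_lt1 : alpha < 1) (a_gt0 : 0 < a).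
Notation H := (qker alpha a).
Variable p : R.
Hypotheses (p_gt0 : 0 < p) (Mp : mellin alpha a p = 0).

Let mD : measurable (D : set (measurableTypeR R)).
Proof. exact: measurable_itv. Qed.

Let mitv (i : interval R) : measurable ([set` i] : set (measurableTypeR R)).
Proof. exact: measurable_itv. Qed.

(** For y > 0 the substitution x = ty gives y^-p G(tau y), with G as in the overview: as the Mellin
    transform vanishes at p, the primitive starting from 0 is the one that vanishes at infinity. *)
Definition primitive (tau y : R) : R :=
  \int[leb]_(t in `]0, tau]) (t `^ (p - 1) * H (t * y)).

Let powH y t := t `^ (p - 1) * H (t * y).
Let powE y t := t `^ (p - 1) * expR (- (t * y)).

Let mpowH y (A : set R) : measurable_fun A (powH y).
Proof.
apply/measurable_funTS/measurable_funM => //.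
by apply: (measurableT_comp (@measurable_qker R alpha a)); exact: mulrr_measurable.
Qed.

Let IE y : 0 < y -> leb.-integrable D (EFin \o powE y).
Proof.
move=> y0; have -> : powE y = (fun t => t `^ (p - 1) * expR (- (y * t))).
  by apply/funext => t; rewrite /powE mulrC [t * y]mulrC mulrC.
exact: integrable_powR_expR.
Qed.

Let IH y : 0 < y -> leb.-integrable D (EFin \o powH y).
Proof.
move=> y0; apply: (le_integrable_EFin mD _ _ (IE y0)); first exact: mpowH.
move=> t _; rewrite normrM ger0_norm ?powR_ge0// ler_wpM2l ?powR_ge0//.
exact: norm_qker.
Qed.

Lemma Rintegral_powR_qker y : 0 < y ->
  \int[leb]_(t in D) (t `^ (p - 1) * H (t * y)) = 0.
Proof.
move=> y0; have yp := powR_gt0 (p - 1) y0.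
have /= := Rintegral_scale y0 (integrable_mellin a alpha_gt0 alpha_lt1 p_gt0).
rewrite -/(mellin _ _ _) Mp mulr0.
rewrite (@eq_Rintegral _ (measurableTypeR R) R leb D (fun t => y `^ (p - 1) * powH y t)); last first.
  move=> t; rewrite inE/= in_itv/= andbT => t0.
  by rewrite powRM ?(ltW y0) ?(ltW t0)// /powH [t * y]mulrC mulrA.
rewrite (RintegralZl _ mD (IH y0)) => E.
by apply: (mulfI (lt0r_neq0 yp)); rewrite mulr0.
Qed.

Let sub0 tau : `]0, tau] `<=` D.
Proof. by move=> x; rewrite /= !in_itv/= andbT => /andP[]. Qed.

Let suby tau : 0 < tau -> `]tau, +oo[ `<=` D.
Proof. by move=> ?; move=> x; rewrite /= !in_itv/= !andbT; exact: lt_trans. Qed.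

Let primitive_lo tau y : 0 < tau -> 0 < y -> tau * y <= a ->
  primitive tau y = \int[leb]_(t in `]0, tau]) ((1 - alpha) * powE y t).
Proof.
move=> tau0 y0 tya; apply: eq_Rintegral => t; rewrite inE/= in_itv/= => /andP[_ tt].
have tya' : t * y <= a by apply: le_trans tya; rewrite ler_pM2r.
by rewrite (qker_le _ tya') mulrCA.
Qed.

(** The integral over the whole half-line is 0, so the primitive is minus its tail, on which H is
    negative. Together with [primitive_lo] this always writes the primitive as the integral of a
    nonnegative function. *)
Let primitive_hi tau y : 0 < tau -> 0 < y -> a < tau * y ->
  primitive tau y = \int[leb]_(t in `]tau, +oo[) (alpha * powE y t).
Proof.
move=> tau0 y0 tya; have := Rintegral_split_pos tau0 (IH y0).
rewrite Rintegral_powR_qker// => /esym/eqP; rewrite addr_eq0 => /eqP E.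
rewrite [LHS]E.
have Iu := integrableS mD (mitv `]tau, +oo[) (suby tau0) (IH y0).
rewrite -mulN1r -(RintegralZl _ (mitv _) Iu); apply: eq_Rintegral => t.
rewrite inE/= in_itv/= andbT => tt.
have tya' : a < t * y by apply: lt_trans tya _; rewrite ltr_pM2r.
rewrite /powH (qker_gt _ tya') /powE.
by rewrite mulN1r mulNr mulrN opprK mulrCA.
Qed.

Let scaleK : R := \int[leb]_(t in D) (t `^ (p - 1) * expR (- (a / 2 * t))).

Let Iscale tau : 0 < tau ->
  leb.-integrable D (EFin \o (fun t => t `^ (p - 1) * expR (- (a / 2 / tau * t)))).
Proof. by move=> tau0; apply: integrable_powR_expR => //; rewrite !divr_gt0. Qed.

Let scaledE tau : 0 < tau ->
  \int[leb]_(t in D) (t `^ (p - 1) * expR (- (a / 2 / tau * t))) = tau `^ p * scaleK.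
Proof.
move=> tau0; have ti0 : 0 < tau^-1 by rewrite invr_gt0.
have a20 : 0 < a / 2 by rewrite divr_gt0.
have /= := Rintegral_scale ti0 (integrable_powR_expR p_gt0 a20).
rewrite -/scaleK invrK => E.
have tp : tau `^ (p - 1) * tau^-1 `^ (p - 1) = 1.
  by rewrite -powRM ?ltW// mulfV ?gt_eqF// powR1.
have -> : tau `^ p * scaleK = tau `^ (p - 1) * (tau * scaleK).
  by rewrite -(mulr_powRB1 (ltW tau0) p_gt0); ring.
rewrite -E -(RintegralZl _ mD (integrable_scale ti0 (integrable_powR_expR p_gt0 a20))).
apply: eq_Rintegral => t; rewrite inE/= in_itv/= andbT => t0.
rewrite powRM ?(ltW ti0) ?(ltW t0)// !mulrA tp mul1r.
by congr (_ * expR (- _)); ring.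
Qed.

(** Both representations are dominated by the same [f], because -ty <= a - tau y/2 - at/(2 tau) in
    either case: one part of the decay is kept in y and the other makes the integral in t converge.
    Scaling then yields tau^p. *)
Lemma primitive_le : exists2 C, 0 <= C & forall tau y, 0 < tau -> 0 < y ->
  primitive tau y <= C * tau `^ p * expR (- (tau / 2 * y)).
Proof.
have K0 : 0 <= scaleK.
  by apply: Rintegral_ge0 => t _; rewrite mulr_ge0 ?powR_ge0 ?expR_ge0.
exists (expR a * scaleK); first by rewrite mulr_ge0 ?expR_ge0.
move=> tau y tau0 y0.
pose f t := expR (a - tau / 2 * y) * (t `^ (p - 1) * expR (- (a / 2 / tau * t))).
have If : leb.-integrable D (EFin \o f) by apply: integrable_EFinZ => //; exact: Iscale.
have f0 t : D t -> 0 <= f t.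
  by move=> _; rewrite !mulr_ge0 ?expR_ge0 ?powR_ge0.
have fE : \int[leb]_(t in D) f t = expR a * scaleK * tau `^ p * expR (- (tau / 2 * y)).
  by rewrite RintegralZl ?scaledE// ?expRD; [ring|exact: Iscale].
have powE_le c t : 0 <= c <= 1 -> 0 < t ->
    - (t * y) <= a - tau / 2 * y - a / 2 / tau * t -> c * powE y t <= f t.
  move=> /andP[c0 c1] t0 le; apply: (@le_trans _ _ (powE y t)).
    by rewrite ler_piMl// mulr_ge0 ?powR_ge0 ?expR_ge0.
  by rewrite /f mulrCA -expRD ler_wpM2l ?powR_ge0// ler_expR.
rewrite -fE; have [tya|tya] := leP (tau * y) a.
  rewrite primitive_lo//; apply: (le_subset_Rintegral (mitv _) mD (@sub0 _) If) => //.
    apply: integrable_EFinZ => //.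
    exact: (integrableS mD (mitv _) (@sub0 _) (IE y0)).
  move=> t; rewrite /= in_itv/= => /andP[t0 tt]; apply: powE_le => //.
    by rewrite subr_ge0 ltW//= gerBl ltW.
  have t1 : a / 2 / tau * t <= a / 2.
    by rewrite mulrAC ler_pdivrMr// ler_pM2l// divr_gt0.
  have t2 : tau / 2 * y <= a / 2 by rewrite mulrAC ler_pM2r ?invr_gt0.
  have t3 : 0 <= t * y by rewrite ltW// mulr_gt0.
  by lra.
rewrite primitive_hi//.
apply: (le_subset_Rintegral (mitv _) mD (suby tau0) If) => //.
  apply: integrable_EFinZ => //.
  exact: (integrableS mD (mitv _) (suby tau0) (IE y0)).
move=> t; rewrite /= in_itv/= andbT => tt; have t0 := lt_trans tau0 tt.
apply: powE_le => //; first by rewrite !ltW.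
have t1 : a / 2 / tau * t <= t * y / 2.
  rewrite (_ : a / 2 / tau * t = (a / tau) * (t / 2)); last by field; rewrite gt_eqF.
  rewrite (_ : t * y / 2 = y * (t / 2)); last by field.
  rewrite ler_pM2r ?divr_gt0// ler_pdivrMr// mulrC ltW//.
have t2 : tau / 2 * y <= t * y / 2.
  by rewrite mulrAC ler_pM2r ?invr_gt0// ler_pM2r// ltW.
by have := a_gt0; lra.
Qed.

(** A box is kept on the side where the representation lives, ]tau/2, tau] or ]tau, 2 tau]. In both
    t <= 2 tau, whence the common exponential. *)
Lemma primitive_ge : exists2 c, 0 < c & forall tau y, 0 < tau -> 0 < y ->
  c * tau `^ p * expR (- (2 * tau * y)) <= primitive tau y.
Proof.
pose h : R := 2^-1 `^ p; have h0 : 0 < h by rewrite powR_gt0.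
have h1 : h <= 1.
  rewrite -[leRHS](_ : 1 `^ p = 1); last by rewrite powR1.
  apply: le_powR; rewrite ?invr_ge0 ?(ltW p_gt0)//.
  by rewrite invf_le1// ler1n.
have b0 : 0 < 1 - alpha by rewrite subr_gt0.
have b1 : 1 - alpha <= 1 by rewrite gerBl ltW.
(* The boxes give (1 - alpha) h / 2 and alpha / 2, where h = 2^-p is the loss in the power at tau/2;
   this constant is below both. *)
exists (alpha * (1 - alpha) * h / 2).
  by rewrite divr_gt0// !mulr_gt0.
move=> tau y tau0 y0; have tp := powR_gt0 p tau0.
have E0 := expR_gt0 (- (2 * tau * y)).
have powE_ge t : 0 < t -> t <= 2 * tau -> t `^ p / t * expR (- (2 * tau * y)) <= powE y t.
  move=> t0 tt; rewrite /powE powRB1// ler_wpM2l ?divr_ge0 ?powR_ge0 ?(ltW t0)//.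
  by rewrite ler_expR lerN2 ler_pM2r.
have tt2 : tau <= 2 * tau by rewrite ler_peMl ?ler1n// ltW.
have [tya|tya] := leP (tau * y) a.
  have t20 : 0 < tau / 2 by rewrite divr_gt0.
  have t2t : tau / 2 < tau by rewrite ltr_pdivrMr// ltr_pMr// ltr1n.
  rewrite primitive_lo//.
  apply: (@le_trans _ _ (((1 - alpha) * ((tau / 2) `^ p / tau * expR (- (2 * tau * y)))) * (tau - tau / 2))).
    rewrite powRM ?invr_ge0 ?(ltW tau0)// -/h.
    rewrite (_ : _ * (tau - tau / 2) = (1 - alpha) * h / 2 * tau `^ p * expR (- (2 * tau * y))); last first.
      by field; rewrite gt_eqF.
    rewrite ler_wpM2r ?expR_ge0// ler_wpM2r ?(ltW tp)// ler_wpM2r ?invr_ge0//.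
    by rewrite ler_wpM2r ?(ltW h0)// ler_piMl// ltW.
  apply: (ge_cst_Rintegral (mitv _)) => //.
  - by move=> t; rewrite /= !in_itv/= => /andP[t0 ->]; rewrite (lt_trans t20).
  - apply: integrable_EFinZ => //.
    exact: (integrableS mD (mitv _) (@sub0 _) (IE y0)).
  - move=> t _; rewrite mulr_ge0 ?(ltW b0)// mulr_ge0 ?powR_ge0 ?expR_ge0//.
  - move=> t /andP[t1 t2]; have t0 := lt_trans t20 t1.
    rewrite ler_wpM2l ?(ltW b0)// (le_trans _ (powE_ge _ t0 (le_trans t2 tt2)))//.
    rewrite ler_wpM2r ?expR_ge0//; apply: ler_pM; rewrite ?powR_ge0 ?invr_ge0 ?(ltW tau0)//.
      by apply: le_powR => //; rewrite ltW.
    by rewrite lef_pV2 ?posrE.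
rewrite primitive_hi//.
apply: (@le_trans _ _ ((alpha * (tau `^ p / (2 * tau) * expR (- (2 * tau * y)))) * (2 * tau - tau))).
  rewrite (_ : _ * (2 * tau - tau) = alpha / 2 * tau `^ p * expR (- (2 * tau * y))); last first.
    by field; rewrite gt_eqF.
  rewrite ler_wpM2r ?expR_ge0// ler_wpM2r ?(ltW tp)// ler_wpM2r ?invr_ge0//.
  rewrite -mulrA ler_piMr ?(ltW alpha_gt0)//.
  by rewrite mulr_ile1 ?(ltW b0) ?(ltW h0).
apply: (ge_cst_Rintegral (mitv _)) => //.
- by rewrite ltr_pMl// ltr1n.
- by move=> t; rewrite /= !in_itv/= andbT => /andP[].
- apply: integrable_EFinZ => //.
  exact: (integrableS mD (mitv _) (suby tau0) (IE y0)).
- by move=> t _; rewrite mulr_ge0 ?(ltW alpha_gt0)// mulr_ge0 ?powR_ge0 ?expR_ge0.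
- move=> t /andP[t1 t2]; have t0 := lt_trans tau0 t1.
  rewrite ler_wpM2l ?(ltW alpha_gt0)// (le_trans _ (powE_ge _ t0 t2))//.
  rewrite ler_wpM2r ?expR_ge0//; apply: ler_pM; rewrite ?powR_ge0 ?invr_ge0 ?mulr_ge0 ?(ltW tau0)//.
    by apply: le_powR; rewrite ltW.
  by rewrite lef_pV2 ?posrE ?mulr_gt0.
Qed.

Lemma measurable_primitive tau : measurable_fun setT (primitive tau).
Proof.
apply: (@measurable_Rintegral2 _ _ _ _ R leb `]0, tau]
  (fun z : measurableTypeR R * measurableTypeR R => z.2 `^ (p - 1) * H (z.2 * z.1))) => //.
apply: measurable_funM.
  exact: (measurableT_comp (measurable_powR (p - 1)) measurable_snd).
by apply: (measurableT_comp (@measurable_qker R alpha a)); exact: measurable_funM.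
Qed.

Lemma primitive_ge0 tau y : 0 < tau -> 0 < y -> 0 <= primitive tau y.
Proof.
move=> tau0 y0; have [c c0 /(_ _ _ tau0 y0)] := primitive_ge; apply: le_trans.
by rewrite mulr_ge0 ?expR_ge0// mulr_ge0 ?powR_ge0// ltW.
Qed.

Section weight.
Variables (mu : {sigma_finite_measure set (measurableTypeR R) -> \bar R}) (w : R -> R).
Hypothesis bw : balanced alpha a mu w.

Lemma integrable_primitive tau : 0 < tau ->
  mu.-integrable D (EFin \o (fun y => primitive tau y * w y)).
Proof.
move=> tau0; have [C C0 CP] := primitive_le.
apply: (@balanced_integrable _ _ _ _ _ bw _ (C * tau `^ p) (tau / 2)).
- exact: measurable_primitive.
- by rewrite divr_gt0.
- by move=> y y0; rewrite ger0_norm ?CP// primitive_ge0.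
Qed.

(** The difference of the primitives is the integral of x^(p-1) H(xy) over ]s, t]. After Fubini the
    inner integral, in y against w, is zero by balance. *)
Lemma primitive_cst s t : 0 < s -> s < t ->
  \int[mu]_(y in D) (primitive t y * w y) = \int[mu]_(y in D) (primitive s y * w y).
Proof.
move=> s0 st; have t0 := lt_trans s0 st; have [mw Iw HI] := bw.
apply/eqP; rewrite -subr_eq0 -RintegralB//; [|exact: integrable_primitive..].
pose f (z : measurableTypeR R * measurableTypeR R) :=
  w z.1 * (z.2 `^ (p - 1) * H (z.2 * z.1)).
have mf : measurable_fun setT f.
  apply: measurable_funM; first exact: (measurableT_comp mw).
  apply: measurable_funM.
    exact: (measurableT_comp (measurable_powR (p - 1)) measurable_snd).
  by apply: (measurableT_comp (@measurable_qker R alpha a)); exact: measurable_funM.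
have std : `]s, t] `<=` D.
  by move=> x; rewrite /= !in_itv/= andbT => /andP[sx _]; exact: lt_trans sx.
have [Ip _] := Rintegral_powR p_gt0 s0 st.
have {}Ip : leb.-integrable `]s, t] (EFin \o (fun x => x `^ (p - 1))).
  by apply: integrableS Ip => //; exact: subset_itv_oc_cc.
have fbound y x : D y -> (`]s, t]%classic : set R) x ->
    `|f (y, x)| <= `|expR (- (s * y)) * w y| * x `^ (p - 1).
  rewrite /= !in_itv/= andbT => y0 /andP[sx xt].
  have -> : `|f (y, x)| = `|w y| * (x `^ (p - 1) * `|H (x * y)|).
    by rewrite /f/= normrM [X in _ * X]normrM [`|_ `^ _|]ger0_norm ?powR_ge0.
  have -> : `|expR (- (s * y)) * w y| * x `^ (p - 1) =
      `|w y| * (x `^ (p - 1) * expR (- (s * y))).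
    by rewrite normrM ger0_norm ?expR_ge0//; ring.
  rewrite ler_wpM2l// ler_wpM2l ?powR_ge0// (le_trans (norm_qker a alpha_gt0 alpha_lt1 _))//.
  by rewrite ler_expR lerN2 ler_pM2r// ltW.
have := @Fubini_dominated _ _ _ _ R mu leb D `]s, t] f
  (fun y => `|expR (- (s * y)) * w y|) (fun x => x `^ (p - 1))
  mD (mitv _) mf (integrable_norm (Iw _ s0)) Ip fbound.
have -> : \int[mu]_(y in D) \int[leb]_(x in `]s, t]) f (y, x) =
    \int[mu]_(y in D) (primitive t y * w y - primitive s y * w y).
  apply: eq_Rintegral => y; rewrite inE/= in_itv/= andbT => y0.
  rewrite -mulrBl mulrC /f/= RintegralZl//; last first.
    exact: (integrableS mD (mitv _) std (IH y0)).
  congr (_ * _); rewrite /primitive Rintegral_itvB//; last 2 first.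
  - by rewrite bnd_simp ltW.
  - by rewrite bnd_simp ltW.
  exact: (integrableS mD (mitv _) (@sub0 _) (IH y0)).
move=> ->; rewrite (@eq_Rintegral _ (measurableTypeR R) R leb _ (fun=> 0)).
  by rewrite Rintegral_cst// mul0r.
move=> x; rewrite inE/= in_itv/= => /andP[sx _]; have x0 := lt_trans s0 sx.
rewrite (@eq_Rintegral _ (measurableTypeR R) R mu D (fun y => x `^ (p - 1) * (H (x * y) * w y))); last first.
  by move=> y _; rewrite /f/=; ring.
rewrite RintegralZl//; first by rewrite HI// mulr0.
apply: (@balanced_integrable _ _ _ _ _ bw _ 1 x) => //.
  by apply: (measurableT_comp (@measurable_qker R alpha a)); exact: mulrl_measurable.
by move=> y _; rewrite mul1r norm_qker.
Qed.

End weight.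
End primitive.

(** * Comparison of the kernel with its primitive *)

Section Rintegral_density.
Context d (T : measurableType d) (R : realType).
Variables nu mu : {measure set T -> \bar R}.
Variables (D : set T) (g : T -> R).
Hypotheses (mD : measurable D) (mg : measurable_fun setT g).
Hypothesis g0 : forall x, 0 <= g x.
Hypothesis nuE : forall A, measurable A -> A `<=` D ->
  (nu A = \int[mu]_(x in A) (g x)%:E)%E.

Let ge0E := ge0_integral_density mD mg g0 nuE.

Lemma integrable_density (f : T -> R) : nu.-integrable D (EFin \o f) ->
  mu.-integrable D (EFin \o (fun x => f x * g x)).
Proof.
move=> /integrableP[mf foo]; have /measurable_EFinP mf' := mf.
apply/integrableP; split.
  by apply/measurable_EFinP/measurable_funM => //; exact: measurable_funTS.
apply: le_lt_trans foo; rewrite ge0E//; last exact: measurableT_comp.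
rewrite le_eqVlt; apply/orP; left; apply/eqP; apply: eq_integral => x _ /=.
by rewrite -EFinM normrM (ger0_norm (g0 x)).
Qed.

Lemma Rintegral_density (f : T -> R) : nu.-integrable D (EFin \o f) ->
  \int[nu]_(x in D) f x = \int[mu]_(x in D) (f x * g x).
Proof.
move=> /integrableP[mf _]; rewrite /Rintegral integralE [in RHS]integralE.
rewrite (ge0E (measurable_funepos mf))// (ge0E (measurable_funeneg mf))//.
congr (fine (_ - _)%E); apply: eq_integral => x _.
  by rewrite !funeposE -!EFin_max -EFinM /= maxr_pMl// mul0r.
by rewrite !funenegE -!EFin_max -EFinM /= maxr_pMl// mul0r mulNr.
Qed.

End Rintegral_density.

Section comparison.
Context (R : realType).
Notation leb := (@lebesgue_measure R).
Notation D := (`]0, +oo[%classic : set R).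
Variables alpha a : R.
Hypotheses (alpha_gt0 : 0 < alpha) (alpha_lt1 : alpha < 1) (a_gt0 : 0 < a).
Notation H := (qker alpha a).
Notation K x := ((a - x) * H x).

Let mD : measurable (D : set (measurableTypeR R)).
Proof. exact: measurable_itv. Qed.

Let mitv (i : interval R) : measurable ([set` i] : set (measurableTypeR R)).
Proof. exact: measurable_itv. Qed.

Let b := alpha * (1 - alpha).

Let b_gt0 : 0 < b. Proof. by rewrite mulr_gt0// subr_gt0. Qed.

(** [b] is below both 1 - alpha and alpha, the absolute values of the coefficient of exp(-x) in H on
    the two sides of a. *)
Lemma kernel_ge (x : R) : b * `|a - x| * expR (- x) <= K x.
Proof.
have b1 : b <= 1 - alpha by rewrite ler_piMl ?subr_ge0 ?ltW.
have b2 : b <= alpha by rewrite ler_piMr ?gerBl ?ltW.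
have [xa|ax] := leP x a.
  rewrite qker_le// ger0_norm ?subr_ge0// mulrA ler_wpM2r ?expR_ge0//.
  by rewrite mulrC ler_wpM2l// subr_ge0.
rewrite qker_gt// ltr0_norm ?subr_lt0//.
have -> : (a - x) * (- alpha * expR (- x)) = alpha * - (a - x) * expR (- x) by ring.
by rewrite ler_wpM2r ?expR_ge0// ler_wpM2r// oppr_ge0 subr_le0 ltW.
Qed.

(** K is weak only near a. If x is within a/4 of a, then x' <= x/2 is below 5a/8, hence further than
    a/4 from a, and its exponential is larger than that of x. The ratio 2 of the radii is what
    separates x' from a. *)
Lemma kernel_add_ge (r r' y : R) : 0 < r -> 2 * r <= r' -> 0 < y ->
  b * (a / 4) * expR (- (a / r * y)) <= K (a / r * y) + K (a / r' * y).
Proof.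
move=> r0 rr' y0; set x := a / r * y; set x' := a / r' * y.
have r'0 : 0 < r' by apply: lt_le_trans rr'; rewrite mulr_gt0.
have x0 : 0 < x by rewrite mulr_gt0// divr_gt0.
have x2 : x' <= x / 2.
  rewrite /x /x' (_ : a / r * y / 2 = a * y * (2 * r)^-1); last by field; rewrite gt_eqF.
  by rewrite mulrAC ler_pM2l ?mulr_gt0// lef_pV2 ?posrE ?mulr_gt0.
have [ax|xa] := leP (a / 4) `|a - x|.
  rewrite -[leLHS]addr0; apply: lerD; last exact: kernel_ge0.
  apply: le_trans (kernel_ge x).
  by rewrite ler_wpM2r ?expR_ge0// ler_wpM2l// ltW.
have xlt : x < 5 / 4 * a.
  by move: xa; rewrite ltr_norml => /andP[+ _]; lra.
rewrite -[leLHS]add0r; apply: lerD; first exact: kernel_ge0.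
apply: le_trans (kernel_ge x'); apply: ler_pM.
- by rewrite mulr_ge0 ?divr_ge0 ?ltW.
- exact: expR_ge0.
- rewrite ler_wpM2l ?(ltW b_gt0)// ger0_norm; have := a_gt0; lra.
- by rewrite ler_expR lerN2; have := x0; lra.
Qed.

Section weight.
Variables (mu : {sigma_finite_measure set (measurableTypeR R) -> \bar R}) (w : R -> R).
Hypothesis bw : balanced alpha a mu w.
Hypothesis w0 : forall y, 0 < y -> 0 <= w y.
Notation Z := (density_factor alpha a mu w).
Notation L t := (\int[mu]_(y in D) (expR (- (t * y)) * w y)).

Let Iew t : 0 < t -> mu.-integrable D (EFin \o (fun y => expR (- (t * y)) * w y)).
Proof. by case: bw => _ + _; exact. Qed.

Let IK s : 0 < s -> mu.-integrable D (EFin \o (fun y => K (s * y) * w y)).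
Proof. by move=> s0; exact: integrable_kernel. Qed.

Lemma density_factor_ge0 s : 0 <= Z s.
Proof.
apply: Rintegral_ge0 => y; rewrite /= in_itv/= andbT => y0.
by rewrite mulr_ge0 ?w0// kernel_ge0.
Qed.

Lemma density_factor_le s : 0 < s -> Z s <= (a + 2) * L (s / 2).
Proof.
move=> s0; have s20 : 0 < s / 2 by rewrite divr_gt0.
rewrite -(RintegralZl _ mD (Iew s20)); apply: (le_Rintegral mD (IK s0)).
  exact: (integrable_EFinZ _ mD (Iew s20)).
move=> y; rewrite /= in_itv/= andbT => y0; rewrite mulrA ler_wpM2r ?w0//.
have sy0 : 0 <= s * y by rewrite mulr_ge0// ltW.
rewrite (le_trans (ler_norm _))// (le_trans (norm_kernel_le alpha_gt0 alpha_lt1 a_gt0 sy0))//.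
by rewrite [s * y / 2]mulrAC.
Qed.

Lemma laplace_weight_le s t : 0 < s -> s <= t -> L t <= L s.
Proof.
move=> s0 st; apply: (le_Rintegral mD (Iew (lt_le_trans s0 st)) (Iew s0)).
move=> y; rewrite /= in_itv/= andbT => y0.
by rewrite ler_wpM2r ?w0// ler_expR lerN2 ler_pM2r.
Qed.

Lemma integrable_density_factor u v : 0 < u -> u < v ->
  leb.-integrable `]u, v] (EFin \o (fun r => Z (a / r) / r)).
Proof.
move=> u0 uv; have v0 := lt_trans u0 uv.
have av0 : 0 < a / v / 2 by rewrite !divr_gt0.
have [Ic _] := Rintegral_cst_itv ((a + 2) * L (a / v / 2) / u) uv.
apply: (le_integrable_EFin (mitv _) _ _ Ic).
  apply/measurable_funTS/measurable_funM; last exact: measurable_inv.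
  apply: (measurableT_comp (measurable_density_factor bw)).
  by apply: measurable_funM => //; exact: measurable_inv.
move=> r; rewrite /= in_itv/= => /andP[ur rv]; have r0 := lt_trans u0 ur.
have ar0 : 0 < a / r by rewrite divr_gt0.
rewrite normrM (ger0_norm (density_factor_ge0 _)) ger0_norm ?invr_ge0 ?(ltW r0)//.
apply: ler_pM; rewrite ?density_factor_ge0 ?invr_ge0 ?(ltW r0)//.
  apply: (le_trans (density_factor_le ar0)); apply: ler_wpM2l.
    by rewrite addr_ge0// ltW.
  apply: laplace_weight_le => //.
  by rewrite ler_pM2r ?invr_gt0// ler_pM2l// lef_pV2 ?posrE.
by rewrite lef_pV2 ?posrE// ltW.
Qed.

Lemma density_factor_add_ge r r' : 0 < r -> 2 * r <= r' ->
  b * (a / 4) * L (a / r) <= Z (a / r) + Z (a / r').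
Proof.
move=> r0 rr'; have r'0 : 0 < r' by apply: lt_le_trans rr'; rewrite mulr_gt0.
have ar0 : 0 < a / r by rewrite divr_gt0.
have ar'0 : 0 < a / r' by rewrite divr_gt0.
rewrite -(RintegralZl _ mD (Iew ar0)) -(RintegralD mD (IK ar0) (IK ar'0)).
apply: (le_Rintegral mD).
- exact: (integrable_EFinZ _ mD (Iew ar0)).
- exact: (integrable_EFinD mD (IK ar0) (IK ar'0)).
- move=> y; rewrite /= in_itv/= andbT => y0.
  by rewrite mulrA -mulrDl ler_wpM2r ?w0// kernel_add_ge.
Qed.

Section root.
Variable p : R.
Hypotheses (p_gt0 : 0 < p) (Mp : mellin alpha a p = 0).

(** The integral does not depend on the first argument of [primitive]; 1 is a normalization. *)
Definition primitive_integral : R :=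
  \int[mu]_(y in D) (primitive alpha a p 1 y * w y).

Lemma primitive_integralE t : 0 < t ->
  \int[mu]_(y in D) (primitive alpha a p t y * w y) = primitive_integral.
Proof.
move=> t0; have [t1|t1|->//] := ltgtP t 1.
  by apply/esym; exact: primitive_cst.
by apply: primitive_cst.
Qed.

(** At tau = t/2 the lower bound on the primitive decays exactly like exp(-ty), so the constancy of
    the integral controls the Laplace transform at every scale. *)
Lemma laplace_weight_bound : exists2 C, 0 <= C & forall t, 0 < t ->
  t `^ p * L t <= C.
Proof.
have [c c0 cP] := primitive_ge alpha_gt0 alpha_lt1 p_gt0 Mp.
have J0 : 0 <= primitive_integral.
  apply: Rintegral_ge0 => y; rewrite /= in_itv/= andbT => y0.
  by rewrite mulr_ge0 ?w0// primitive_ge0.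
exists (2 `^ p / c * primitive_integral).
  by rewrite mulr_ge0// divr_ge0 ?powR_ge0// ltW.
move=> t t0; have t20 : 0 < t / 2 by rewrite divr_gt0.
have le : c * (t / 2) `^ p * L t <= primitive_integral.
  rewrite -(primitive_integralE t20) -(RintegralZl _ mD (Iew t0)).
  apply: (le_Rintegral mD); [exact: (integrable_EFinZ _ mD (Iew t0))|exact: integrable_primitive|].
  move=> y; rewrite /= in_itv/= andbT => y0; rewrite mulrA; apply: ler_wpM2r; first exact: w0.
  by have := cP _ _ t20 y0; have -> : 2 * (t / 2) = t by field.
have tE : t `^ p = 2 `^ p * (t / 2) `^ p.
  by rewrite -powRM ?ltW//; congr (_ `^ _); field.
have -> : t `^ p * L t = 2 `^ p / c * (c * (t / 2) `^ p * L t).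
  by rewrite tE; field; rewrite gt_eqF.
by apply: ler_wpM2l => //; rewrite divr_ge0 ?powR_ge0// ltW.
Qed.

(** At tau = 2a/r the upper bound on the primitive decays exactly like exp(-ay/r). *)
Lemma primitive_integral_le : exists2 C, 0 < C & forall r, 0 < r ->
  primitive_integral * r `^ p <= C * L (a / r).
Proof.
have [C C0 CP] := primitive_le alpha_gt0 alpha_lt1 a_gt0 p_gt0 Mp.
(* [C] is only known to be nonnegative; the summand 1 makes the constant positive, so that it can be
   divided by. *)
exists ((C + 1) * (2 * a) `^ p); first by rewrite mulr_gt0 ?powR_gt0 ?ltr_wpDl ?mulr_gt0.
move=> r r0; have ar0 : 0 < a / r by rewrite divr_gt0.
have t0 : 0 < 2 * a / r by rewrite divr_gt0// mulr_gt0.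
have L0 : 0 <= L (a / r).
  apply: Rintegral_ge0 => y; rewrite /= in_itv/= andbT => y0.
  by rewrite mulr_ge0 ?w0// expR_ge0.
have le : primitive_integral <= C * (2 * a / r) `^ p * L (a / r).
  rewrite -(primitive_integralE t0) -(RintegralZl _ mD (Iew ar0)).
  apply: (le_Rintegral mD); [exact: integrable_primitive|exact: (integrable_EFinZ _ mD (Iew ar0))|].
  move=> y; rewrite /= in_itv/= andbT => y0; rewrite mulrA; apply: ler_wpM2r; first exact: w0.
  have := CP _ _ t0 y0; have -> // : 2 * a / r / 2 = a / r.
  by field; rewrite gt_eqF.
have rp := powR_gt0 p r0.
apply: (le_trans (ler_wpM2r (ltW rp) le)).
have -> : (2 * a) `^ p = (2 * a / r) `^ p * r `^ p.
  rewrite -powRM ?(ltW r0) ?(ltW t0)//; congr (_ `^ _); field.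
  by rewrite gt_eqF.
have -> : C * (2 * a / r) `^ p * L (a / r) * r `^ p =
  C * ((2 * a / r) `^ p * r `^ p * L (a / r)) by ring.
rewrite -[leRHS]mulrA ler_wpM2r ?lerDl//.
by rewrite mulr_ge0// mulr_ge0 ?powR_ge0.
Qed.

End root.
End weight.
End comparison.

(** * Uniqueness up to a constant *)

Section power_weight.
Context (R : realType).
Notation leb := (@lebesgue_measure R).
Notation D := (`]0, +oo[%classic : set R).
Variables alpha a : R.
Hypotheses (alpha_gt0 : 0 < alpha) (alpha_lt1 : alpha < 1) (a_gt0 : 0 < a).
Notation H := (qker alpha a).
Notation K x := ((a - x) * H x).
Variable p : R.
Hypotheses (p_gt0 : 0 < p) (Mp : mellin alpha a p = 0).
Notation w0 := (fun y : R => y `^ (p - 1)).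

Let mD : measurable (D : set (measurableTypeR R)).
Proof. exact: measurable_itv. Qed.

Let mitv (i : interval R) : measurable ([set` i] : set (measurableTypeR R)).
Proof. exact: measurable_itv. Qed.

Lemma balanced_powR : balanced alpha a leb w0.
Proof.
split; first exact: measurable_powR.
- move=> t t0; have -> : (fun y => expR (- (t * y)) * w0 y) = (fun y => w0 y * expR (- (t * y))).
    by apply/funext => y; rewrite mulrC.
  exact: integrable_powR_expR.
- move=> t t0; rewrite -[RHS](Rintegral_powR_qker alpha_gt0 alpha_lt1 p_gt0 Mp t0).
  by apply: eq_Rintegral => y _; rewrite mulrC [t * y]mulrC.
Qed.

Let IK s : 0 < s -> leb.-integrable D (EFin \o (fun y => K (s * y) * w0 y)).
Proof. by move=> s0; exact: (integrable_kernel alpha_gt0 alpha_lt1 a_gt0 balanced_powR). Qed.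

(** Scaling shows that the left-hand side is a multiple of r^p. The multiple is not computed from
    the kernel: it is read off from the density equation on ]1, 2], the density of the power being
    known. *)
Lemma density_factor_powR r : 0 < r ->
  density_factor alpha a leb w0 (a / r) = expR (- a) * r `^ p.
Proof.
pose Z0 := density_factor alpha a leb w0.
have scal s : 0 < s -> Z0 s * s `^ p = Z0 1.
  move=> s0; have I1 := IK ltr01.
  have := Rintegral_scale s0 I1.
  have -> : \int[leb]_(x in D) (K (1 * (s * x)) * w0 (s * x)) = s `^ (p - 1) * Z0 s.
    rewrite -(RintegralZl _ mD (IK s0)); apply: eq_Rintegral => y.
    rewrite inE/= in_itv/= andbT => y0.
    by rewrite mul1r powRM ?(ltW s0) ?(ltW y0)//; ring.
  rewrite -/(Z0 1) => E; rewrite -(mulr_powRB1 (ltW s0) p_gt0).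
  have -> : Z0 s * (s * s `^ (p - 1)) = s * (s `^ (p - 1) * Z0 s) by ring.
  by rewrite E mulVKf// gt_eqF.
have Zr r0 : 0 < r0 -> Z0 (a / r0) = Z0 1 / a `^ p * r0 `^ p.
  move=> r00; have ar0 : 0 < a / r0 by rewrite divr_gt0.
  rewrite -(scal _ ar0) powRM ?(ltW a_gt0) ?invr_ge0 ?(ltW r00)//.
  have -> : r0^-1 `^ p = (r0 `^ p)^-1 by rewrite -[r0^-1]powR_inv1 ?(ltW r00)// -powRrM mulN1r powRN.
  by field; rewrite !gt_eqF ?powR_gt0.
have one_two : (1 : R) < 2 by rewrite ltr1n.
have := balanced_density alpha_gt0 alpha_lt1 a_gt0 balanced_powR ltr01 one_two.
have [I12 P12] := Rintegral_powR p_gt0 ltr01 one_two.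
have {}I12 : leb.-integrable `]1, 2] (EFin \o w0).
  by apply: integrableS I12 => //; exact: subset_itv_oc_cc.
have pos : 0 < (2 `^ p - 1 `^ p) / p.
  rewrite divr_gt0// subr_gt0; apply: gt0_ltr_powR => //; rewrite ?nnegrE//.
have -> : \int[leb]_(r in `]1, 2]) (density_factor alpha a leb w0 (a / r) / r) =
    Z0 1 / a `^ p * \int[leb]_(r in `]1, 2]) w0 r.
  rewrite -(RintegralZl _ (mitv _) I12); apply: eq_Rintegral => x.
  rewrite inE/= in_itv/= => /andP[x1 _]; have x0 : 0 < x by apply: lt_trans x1.
  by rewrite -/(Z0 _) Zr// powRB1// mulrA.
rewrite P12 => /(mulIf (lt0r_neq0 pos)) E r0.
by rewrite -/(Z0 _) Zr// -E.
Qed.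

End power_weight.

(** * The extremal multiple of the power solution *)

Section core.
Context (R : realType).
Notation leb := (@lebesgue_measure R).
Notation D := (`]0, +oo[%classic : set R).
Variables alpha a : R.
Hypotheses (alpha_gt0 : 0 < alpha) (alpha_lt1 : alpha < 1) (a_gt0 : 0 < a).
Notation H := (qker alpha a).
Notation K x := ((a - x) * H x).
Variable p : R.
Hypotheses (p_gt0 : 0 < p) (Mp : mellin alpha a p = 0).
Variable mu : {sigma_finite_measure set (measurableTypeR R) -> \bar R}.
Hypothesis bmu : balanced alpha a mu (fun=> 1).
Notation Z := (density_factor alpha a mu (fun=> 1)).
Notation w0 := (fun y : R => y `^ (p - 1)).

Let mD : measurable (D : set (measurableTypeR R)).
Proof. exact: measurable_itv. Qed.

Let mitv (i : interval R) : measurable ([set` i] : set (measurableTypeR R)).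
Proof. exact: measurable_itv. Qed.

Let one_ge0 (y : R) : 0 < y -> 0 <= (fun=> 1) y :> R. Proof. by []. Qed.

Let Z_ge0 s : 0 <= Z s.
Proof. exact: (density_factor_ge0 a alpha_gt0 alpha_lt1 mu one_ge0). Qed.

Lemma integrable_itv1 v : 0 < v -> mu.-integrable `]0, v] (EFin \o (fun=> 1)).
Proof.
move=> v0; have [_ I _] := bmu.
have subD : `]0, v] `<=` D by move=> x; rewrite /= !in_itv/= andbT => /andP[].
have Iv := integrable_EFinZ (expR v) (mitv `]0, v]) (integrableS mD (mitv _) subD (I _ ltr01)).
apply: (le_integrable_EFin (mitv _) _ _ Iv) => //.
move=> y; rewrite /= in_itv/= => /andP[y0 yv].
by rewrite normr1 mul1r mulr1 -expRD -expR0 ler_expR subr_ge0.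
Qed.

Lemma finite_itv v : 0 < v -> (mu `]0%R, v]%classic < +oo)%E.
Proof.
move=> v0; have := integrable_lty (mitv _) (integrable_itv1 v0).
rewrite (eq_integral (cst 1%E))// integral_cst ?mul1e//; exact: mitv.
Qed.

(** The density of [mu] furnished by the density equation, set to 0 off the half-line so that it is
    nonnegative on the whole line, as [mdensity] demands. *)
Let q : R -> R := (fun r => expR a * (Z (a / r) / r)) \_ D.

Let qE r : 0 < r -> q r = expR a * (Z (a / r) / r).
Proof. by move=> r0; rewrite /q patchE mem_set//= in_itv/= r0. Qed.

Let q_ge0 r : 0 <= q r.
Proof.
rewrite /q patchE; case: ifPn => // /[!inE]; rewrite /= in_itv/= andbT => r0.
by rewrite mulr_ge0 ?expR_ge0// mulr_ge0 ?Z_ge0// invr_ge0 ltW.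
Qed.

Let mq : measurable_fun setT q.
Proof.
have m : measurable_fun setT (fun r : R => expR a * (Z (a / r) / r)).
  apply: measurable_funM => //; apply: measurable_funM; last exact: measurable_inv.
  apply: (measurableT_comp (measurable_density_factor bmu)).
  by apply: measurable_funM => //; exact: measurable_inv.
exact: ((measurable_restrictT _ mD).1 (measurable_funTS m)).
Qed.

(** [balanced_density] gives the equality on the intervals ]u, v] with u > 0, which determine a
    measure on the half-line. *)
Lemma mu_density A : measurable A -> A `<=` D ->
  (mu A = \int[leb]_(x in A) (q x)%:E)%E.
Proof.
move=> mA AD; apply: (@measure_unique_pos R mu (mdensity leb mq q_ge0)) => //; last exact: finite_itv.
move=> u v u0 uv; have v0 := lt_trans u0 uv.
have Iuv := integrable_EFinZ (expR a) (mitv _)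
  (integrable_density_factor alpha_gt0 alpha_lt1 a_gt0 bmu one_ge0 u0 uv).
have sub : `]u, v] `<=` `]0, v].
  by move=> x; rewrite /= !in_itv/= => /andP[ux ->]; rewrite (lt_trans u0 ux).
have I1 := integrableS (mitv _) (mitv _) sub (integrable_itv1 v0).
transitivity (\int[leb]_(x in `]u, v]) (expR a * (Z (a / x) / x))%:E)%E; last first.
  apply: eq_integral => x; rewrite inE/= in_itv/= => /andP[ux _].
  by rewrite qE// (lt_trans u0).
rewrite (integrable_EFinE (mitv _) Iuv) RintegralZl//; last first.
  exact: (integrable_density_factor alpha_gt0 alpha_lt1 a_gt0 bmu one_ge0 u0 uv).
rewrite -(balanced_density alpha_gt0 alpha_lt1 a_gt0 bmu u0 uv).
rewrite mulrA -expRD subrr expR0 mul1r -(integrable_EFinE (mitv _) I1).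
rewrite (eq_integral (cst 1%E))// integral_cst ?mul1e//; exact: mitv.
Qed.

Let transfer (f : R -> R) : mu.-integrable D (EFin \o (fun y => f y * 1)) ->
  leb.-integrable D (EFin \o (fun y => f y * q y)) /\
  \int[mu]_(y in D) (f y * 1) = \int[leb]_(y in D) (f y * q y).
Proof.
have -> : (fun y => f y * 1) = f by apply/funext => y; rewrite mulr1.
move=> If; split; first exact: (integrable_density mD mq q_ge0 mu_density If).
exact: (Rintegral_density mD mq q_ge0 mu_density If).
Qed.

Let bq : balanced alpha a leb q.
Proof.
have [_ I HI] := bmu; split=> // t t0; first exact: (transfer (I _ t0)).1.
rewrite -[RHS](HI _ t0); apply/esym; apply: (transfer _).2.
apply: (@balanced_integrable _ _ _ _ _ bmu _ 1 t) => //.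
  by apply: (measurableT_comp (@measurable_qker R alpha a)); exact: mulrl_measurable.
by move=> y _; rewrite mul1r norm_qker.
Qed.

Let ZqE s : 0 < s -> density_factor alpha a leb q s = Z s.
Proof.
move=> s0; apply/esym.
exact: (transfer (integrable_kernel alpha_gt0 alpha_lt1 a_gt0 bmu s0)).2.
Qed.

Let S : set R := [set expR a * Z (a / r) / r `^ p | r in D].

(** Z(a/r) is at most (a + 2) times the Laplace transform at a/(2r), which is at most a constant
    times r^p. *)
Let hS : has_sup S.
Proof.
split; first by exists (expR a * Z (a / 1) / 1 `^ p); exists 1 => //=; rewrite in_itv/= ltr01.
have [C C0 CP] := laplace_weight_bound alpha_gt0 alpha_lt1 a_gt0 bmu one_ge0 p_gt0 Mp.
exists (expR a * ((a + 2) * (C / (a / 2) `^ p))); move=> z [r rD <-].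
move: rD; rewrite /= in_itv/= andbT => r0; have ar0 : 0 < a / r by rewrite divr_gt0.
have ar20 : 0 < a / r / 2 by rewrite divr_gt0.
rewrite -mulrA ler_wpM2l ?expR_ge0// ler_pdivrMr ?powR_gt0//.
apply: (le_trans (density_factor_le alpha_gt0 alpha_lt1 a_gt0 bmu one_ge0 ar0)).
have -> : (a + 2) * (C / (a / 2) `^ p) * r `^ p = (a + 2) * (C / (a / r / 2) `^ p).
  have -> : a / 2 = (a / r / 2) * r by field; rewrite gt_eqF.
  rewrite powRM ?(ltW r0) ?(ltW ar20)//; field.
  by rewrite !gt_eqF ?powR_gt0.
apply: ler_wpM2l; first by rewrite addr_ge0// ltW.
by rewrite ler_pdivlMr ?powR_gt0// mulrC CP.
Qed.

Let M := sup S.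

Let ZM r : 0 < r -> expR a * Z (a / r) <= M * r `^ p.
Proof.
move=> r0; rewrite -ler_pdivrMr ?powR_gt0//;
have Sr : S (expR a * Z (a / r) / r `^ p) by exists r => //=; rewrite in_itv/= r0.
exact: (sup_upper_bound hS Sr).
Qed.

Let M_ge0 : 0 <= M.
Proof.
have := ZM ltr01; rewrite powR1 mulr1; apply: le_trans.
by rewrite mulr_ge0 ?expR_ge0.
Qed.

Let q' y := M * y `^ (p - 1) - q y.

Let q'_ge0 y : 0 < y -> 0 <= q' y.
Proof.
move=> y0; rewrite subr_ge0 qE// powRB1// mulrA mulrA ler_pM2r ?invr_gt0//.
exact: ZM.
Qed.

Let bq' : balanced alpha a leb q'.
Proof.
have [m0 I0 H0] := balanced_powR alpha_gt0 alpha_lt1 p_gt0 Mp.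
have [m1 I1 H1] := bq; split.
- by apply: measurable_funB => //; exact: measurable_funM.
- move=> t t0; have -> : (fun y => expR (- (t * y)) * q' y) =
    (fun y => M * (expR (- (t * y)) * y `^ (p - 1)) - expR (- (t * y)) * q y).
    by apply/funext => y; rewrite /q'; ring.
  apply: (integrable_EFinB mD _ (I1 _ t0)).
  exact: (integrable_EFinZ _ mD (I0 _ t0)).
- move=> t t0.
  have IH w : balanced alpha a leb w -> leb.-integrable D (EFin \o (fun y => H (t * y) * w y)).
    move=> bw; apply: (@balanced_integrable _ _ _ _ _ bw _ 1 t) => //.
      by apply: (measurableT_comp (@measurable_qker R alpha a)); exact: mulrl_measurable.
    by move=> y _; rewrite mul1r norm_qker.
  have IH0 := IH _ (balanced_powR alpha_gt0 alpha_lt1 p_gt0 Mp); have IH1 := IH _ bq.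
  transitivity (\int[leb]_(y in D) (M * (H (t * y) * y `^ (p - 1)) - H (t * y) * q y)).
    by apply: eq_Rintegral => y _; rewrite /q'; ring.
  rewrite (RintegralB mD (integrable_EFinZ M mD IH0) IH1) (RintegralZl _ mD IH0).
  by rewrite (H0 _ t0) (H1 _ t0) mulr0 subr0.
Qed.

Notation Z' := (density_factor alpha a leb q').

Let Z'E r : 0 < r -> Z' (a / r) = M * (expR (- a) * r `^ p) - Z (a / r).
Proof.
move=> r0; have ar0 : 0 < a / r by rewrite divr_gt0.
have I0 := integrable_kernel alpha_gt0 alpha_lt1 a_gt0 (balanced_powR alpha_gt0 alpha_lt1 p_gt0 Mp) ar0.
have I1 := integrable_kernel alpha_gt0 alpha_lt1 a_gt0 bq ar0.
rewrite -(ZqE ar0) -(density_factor_powR alpha_gt0 alpha_lt1 a_gt0 p_gt0 Mp r0).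
rewrite -[X in X - _](RintegralZl _ mD I0) -(RintegralB mD (integrable_EFinZ M mD I0) I1).
by apply: eq_Rintegral => y _; rewrite /q'; ring.
Qed.

(** Derived from explicit values of the density factors, this holds at every r and not just almost
    everywhere, so that bounds on [Z'] at single points can be used for q'. *)
Let q'E r : 0 < r -> q' r = expR a * Z' (a / r) / r.
Proof.
move=> r0; rewrite /q' qE// Z'E// powRB1// mulrBr.
have -> : expR a * (M * (expR (- a) * r `^ p)) = expR a * expR (- a) * (M * r `^ p) by ring.
by rewrite -expRD subrr expR0; ring.
Qed.

Let b := alpha * (1 - alpha).

Let b_gt0 : 0 < b. Proof. by rewrite mulr_gt0// subr_gt0. Qed.

(* The kernel vanishes at y = r only, so a small value of q' at r forces q' to
   be large on ]2r, 4r], which in turn bounds q' from below at r. *)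
Let Z'_ge d : 0 < d ->
  (forall r r', 0 < r -> 2 * r <= r' -> d * r `^ p <= Z' (a / r) + Z' (a / r')) ->
  exists2 e, 0 < e & forall r, 0 < r -> e * r `^ p <= Z' (a / r).
Proof.
(* On ]2r, 4r] the argument ay/r lies in [2a, 4a], so the kernel is at least b a exp(-4a); q' is at
   least exp(a) (d/2) r^p / (4r) there; the length is 2r. The product is c r^p. *)
move=> d0 dP; pose c := b * a * expR (- (4 * a)) * (expR a * (d / 2) / 4) * 2.
have c0 : 0 < c by rewrite !mulr_gt0 ?subr_gt0 ?expR_gt0 ?invr_gt0.
exists (Num.min (d / 2) c); first by rewrite lt_min c0 divr_gt0.
move=> r r0; have rp := powR_gt0 p r0.
have [le|lt] := leP (d / 2 * r `^ p) (Z' (a / r)).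
  by apply: le_trans le; rewrite ler_pM2r// ge_min lexx.
apply: (@le_trans _ _ (c * r `^ p)); first by rewrite ler_pM2r// ge_min lexx orbT.
have far r' : 2 * r <= r' -> d / 2 * r `^ p <= Z' (a / r').
  move=> rr'; have := dP _ _ r0 rr'; move: lt; set z := Z' (a / r); set z' := Z' (a / r').
  have -> : d * r `^ p = d / 2 * r `^ p + d / 2 * r `^ p by field.
  by move=> h1 h2; lra.
have r2 : 2 * r < 4 * r by rewrite ltr_pM2r// ltr_nat.
have r20 : 0 < 2 * r by rewrite mulr_gt0.
have ar0 : 0 < a / r by rewrite divr_gt0.
pose m := b * a * expR (- (4 * a)) * (expR a * (d / 2 * r `^ p) / (4 * r)).
have -> : c * r `^ p = m * (4 * r - 2 * r) by rewrite /c /m; field; rewrite gt_eqF.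
apply: (ge_cst_Rintegral mD r2).
- by move=> y; rewrite /= !in_itv/= andbT => /andP[+ _]; exact: lt_trans.
- exact: (integrable_kernel alpha_gt0 alpha_lt1 a_gt0 bq' ar0).
- move=> y; rewrite /= in_itv/= andbT => y0.
  by rewrite mulr_ge0 ?q'_ge0// kernel_ge0.
- move=> y /andP[ry yr]; have y0 := lt_trans r20 ry.
  apply: ler_pM.
  + by rewrite ltW// !mulr_gt0 ?subr_gt0 ?expR_gt0.
  + by rewrite ltW// divr_gt0 ?mulr_gt0 ?expR_gt0.
  + have x2 : 2 * a <= a / r * y.
      rewrite mulrAC ler_pdivlMr//; have -> : 2 * a * r = a * (2 * r) by ring.
      by rewrite ler_pM2l// ltW.
    have x4 : a / r * y <= 4 * a.
      by rewrite mulrAC ler_pdivrMr// [4 * a]mulrC -mulrA ler_pM2l.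
    apply: (le_trans _ (kernel_ge a alpha_gt0 alpha_lt1 _)); apply: ler_pM.
    * by rewrite ltW// mulr_gt0.
    * exact: expR_ge0.
    * rewrite ler_pM2l// ler0_norm; have := a_gt0; lra.
    * by rewrite ler_expR lerN2.
  + rewrite q'E//; apply: ler_pM.
    * by rewrite ltW// !mulr_gt0 ?subr_gt0 ?expR_gt0.
    * by rewrite invr_ge0 mulr_ge0// ltW.
    * by rewrite ler_pM2l ?expR_gt0// far// ltW.
    * by rewrite lef_pV2 ?posrE ?mulr_gt0.
Qed.

Let primitive_integral0 : primitive_integral alpha a leb q' p = 0.
Proof.
apply/eqP; apply/negPn/negP => J_neq0.
have J0 : 0 < primitive_integral alpha a leb q' p.
  rewrite lt_neqAle eq_sym J_neq0/=; apply: Rintegral_ge0 => y.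
  rewrite /= in_itv/= andbT => y0; rewrite mulr_ge0 ?q'_ge0//.
  exact: (primitive_ge0 alpha_gt0 alpha_lt1 p_gt0 Mp).
have [C C0 CP] := primitive_integral_le alpha_gt0 alpha_lt1 a_gt0 bq' q'_ge0 p_gt0 Mp.
pose J := primitive_integral alpha a leb q' p.
have k0 : 0 < b * (a / 4) by rewrite mulr_gt0// divr_gt0.
have d0 : 0 < b * (a / 4) * (J / C) by rewrite mulr_gt0// divr_gt0.
have [|e e0 eP] := Z'_ge d0.
  move=> r r' r0 rr'.
  apply: le_trans (density_factor_add_ge alpha_gt0 alpha_lt1 a_gt0 bq' q'_ge0 r0 rr').
  have -> : b * (a / 4) * (J / C) * r `^ p = b * (a / 4) * (J * r `^ p / C) by ring.
  by rewrite ler_pM2l// ler_pdivrMr// [X in _ <= X]mulrC; exact: CP.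
(* The uniform bound on [Z'] makes M - exp(a) e an upper bound of [S], smaller than its supremum. *)
suff : M <= M - expR a * e by rewrite lerBrDr gerDl leNgt mulr_gt0 ?expR_gt0.
apply: sup_le_ub; first by have [] := hS.
move=> z [r rD <-]; move: rD; rewrite /= in_itv/= andbT => r0.
rewrite ler_pdivrMr ?powR_gt0//; have := eP _ r0; rewrite Z'E// => le.
have := ler_wpM2l (expR_ge0 a) le; rewrite mulrBr.
have -> : expR a * (M * (expR (- a) * r `^ p)) = expR a * expR (- a) * (M * r `^ p) by ring.
rewrite -expRD subrr expR0 mul1r mulrBl mulrA; lra.
Qed.

(** The primitive is strictly positive, so the vanishing of [primitive_integral] for the nonnegative
    q' forces q' = 0 almost everywhere. *)
Lemma balanced_powerE : exists2 c, 0 <= c & forall A, measurable A -> A `<=` D ->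
  (mu A = \int[leb]_(x in A) (c * x `^ (p - 1))%:E)%E.
Proof.
exists M => // A mA AD; rewrite mu_density//.
have ae0 := Rintegral_eq0_ae mD (integrable_primitive alpha_gt0 alpha_lt1 a_gt0 p_gt0 Mp bq' ltr01) _
  primitive_integral0.
have {}ae0 : ae_eq leb D (EFin \o (fun y => primitive alpha a p 1 y * q' y)) (cst 0%E).
  apply: ae0 => y; rewrite /= in_itv/= andbT => y0; rewrite mulr_ge0 ?q'_ge0//.
  exact: (primitive_ge0 alpha_gt0 alpha_lt1 p_gt0 Mp).
apply: ge0_ae_eq_integral => //.
- by apply/measurable_EFinP/measurable_funTS.
- by apply/measurable_EFinP/measurable_funTS/measurable_funM.
- by move=> x _; rewrite lee_fin.
- by move=> x _; rewrite lee_fin mulr_ge0 ?powR_ge0.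
apply: filterS ae0 => y yD Ay; have := yD (AD _ Ay); have := AD _ Ay.
rewrite /= in_itv/= andbT => y0 [] /eqP; rewrite mulf_eq0.
have [c c0 /(_ _ _ ltr01 y0) cP] := primitive_ge alpha_gt0 alpha_lt1 p_gt0 Mp.
rewrite gt_eqF/=; last by apply: lt_le_trans cP; rewrite !mulr_gt0 ?powR_gt0 ?expR_gt0.
by rewrite subr_eq0 => /eqP ->.
Qed.

End core.

(** * From quantiles to the balanced equation *)

Section sigma_finite_copy.
Context d (T : measurableType d) (R : realType) (Q : {measure set T -> \bar R}).

(** An alias of [Q] that carries its sigma-finiteness as a structure, the form in which the lemmas
    on [balanced] expect it. *)
Definition sigma_finite_copy (_ : sigma_finite setT Q) : set T -> \bar R := Q.

Variable sfQ : sigma_finite setT Q.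

HB.instance Definition _ := Measure.copy (sigma_finite_copy sfQ) Q.
HB.instance Definition _ :=
  @Measure_isSigmaFinite.Build _ _ _ (sigma_finite_copy sfQ) sfQ.

End sigma_finite_copy.

Section exponential_family.
Context (R : realType).
Notation leb := (@lebesgue_measure R).
Notation D := (`]0, +oo[%classic : set R).
Variables (Q : {measure set (measurableTypeR R) -> \bar R}) (alpha a : R).
Hypothesis Q_radon : radon_nonneg Q.
Hypothesis L_fin : forall t : R, 0 < t -> (laplace Q t < +oo)%E.
Hypotheses (alpha_gt0 : 0 < alpha) (alpha_lt1 : alpha < 1) (a_gt0 : 0 < a).
Hypothesis quantile : forall t : R, 0 < t ->
  (\int[Q]_(y in `]0%R, (a / t)%R[) (expR (- (t * y)))%:E
     <= alpha%:E * laplace Q t)%E /\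
  (alpha%:E * laplace Q t
     <= \int[Q]_(y in `]0%R, (a / t)%R]) (expR (- (t * y)))%:E)%E.

Let mD : measurable (D : set (measurableTypeR R)).
Proof. exact: measurable_itv. Qed.

Let mitv (i : interval R) : measurable ([set` i] : set (measurableTypeR R)).
Proof. exact: measurable_itv. Qed.

Let mE t : measurable_fun setT (fun y : R => expR (- (t * y))).
Proof.
apply: measurableT_comp => //; apply: measurable_funN; exact: mulrl_measurable.
Qed.

Let mEe t (A : set (measurableTypeR R)) : measurable_fun A (fun y : R => (expR (- (t * y)))%:E).
Proof. by apply/measurable_EFinP/measurable_funTS; exact: mE. Qed.

Lemma radon_sigma_finite : sigma_finite setT Q.
Proof.
exists (fun n => `[- n%:R, n%:R]%classic); first by rewrite bigcup_itvT.
by move=> n; split; [exact: mitv|apply: Q_radon.2; exact: segment_compact].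
Qed.

Let m0 : measurable ([set 0] : set (measurableTypeR R)).
Proof. exact: measurable_set1. Qed.

(** An atom at 0 contributes to the Laplace transform for every t, but the quantile intervals leave
    0 out. As t grows the right-hand side tends to 0, which excludes the atom. *)
Let atom_le t : 0 < t -> (alpha%:E * Q [set 0%R] <= Q `]0%R, (a / t)%R]%classic)%E.
Proof.
move=> t0; have [_ qt] := quantile t0.
have le1 : (Q [set 0%R] <= laplace Q t)%E.
  have -> : (Q [set 0%R] = \int[Q]_(y in [set 0%R]) (expR (- (t * y)))%:E)%E.
    transitivity (\int[Q]_(y in [set 0%R]) (cst 1%E y))%E.
      by rewrite (integral_cst Q m0) mul1e.
    by apply: eq_integral => y /[!inE] ->; rewrite mulr0 oppr0 expR0.
  apply: (ge0_subset_integral Q m0 (mitv `[0, +oo[)) => //.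
  by move=> y ->; rewrite /= in_itv/= lexx.
apply: (@le_trans _ _ (alpha%:E * laplace Q t)%E).
  by apply: lee_wpmul2l => //; rewrite lee_fin ltW.
apply: (le_trans qt).
have -> : (Q `]0%R, (a / t)%R]%classic = \int[Q]_(y in `]0%R, (a / t)%R]) (cst 1%E y))%E.
  by rewrite (integral_cst Q (mitv _)) mul1e.
apply: (ge0_le_integral Q (mitv _)) => //.
move=> y; rewrite /= in_itv/= => /andP[y0 _]; rewrite lee_fin expR_le1 oppr_le0.
by rewrite mulr_ge0// ltW.
Qed.

Let Q0 : Q [set 0] = 0%E.
Proof.
pose F (n : nat) : set (measurableTypeR R) := `]0, n.+1%:R^-1]%classic.
have F0 : \bigcap_n F n = set0.
  rewrite -subset0 => x Fx; have := Fx 0%N I; rewrite /F /= in_itv/= => /andP[x0 _].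
  have := Fx (Num.trunc x^-1) I; rewrite /F /= in_itv/= => /andP[_].
  apply/negP; rewrite -ltNge invf_plt ?posrE//.
  by rewrite truncnS_gt.
have Q_cvg : (Q \o F) n @[n --> \oo] --> Q (\bigcap_n F n).
  apply: nonincreasing_cvg_mu.
  - apply: le_lt_trans (Q_radon.2 _ (@segment_compact _ 0 1)).
    apply: le_measure; rewrite ?inE; [exact: mitv|exact: mitv|].
    by move=> x; rewrite /F /= !in_itv/= invr1 => /andP[/ltW -> ->].
  - by move=> n; exact: mitv.
  - by rewrite F0.
  - move=> m n mn; apply/subsetPset => x; rewrite /F /= !in_itv/= => /andP[-> xn].
    by rewrite (le_trans xn)// lef_pV2 ?posrE// ler_nat ltnS.
have : (alpha%:E * Q [set 0%R] <= Q (\bigcap_n F n))%E.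
  apply: cvge_ge Q_cvg; apply: nearW => n.
  have t0 : 0 < a * n.+1%:R by rewrite mulr_gt0.
  have := atom_le t0; have -> // : a / (a * n.+1%:R) = n.+1%:R^-1.
  by rewrite invfM mulrA divff ?mul1r// gt_eqF.
rewrite F0 measure0 => le0; apply/eqP; rewrite eq_le measure_ge0 andbT leNgt.
apply/negP => Qgt0; have := mule_gt0 _ Qgt0; move=> /(_ alpha%:E).
by rewrite lte_fin => /(_ alpha_gt0); rewrite ltNge le0.
Qed.

Let Qle0 : Q `]-oo, 0]%classic = 0%E.
Proof.
rewrite -(setUitv1 (a := -oo%O) (x := 0) true)//.
by rewrite (measureU0 (mitv _) m0 Q0) Q_radon.1.
Qed.

Lemma radon_integral_pos (A : set (measurableTypeR R)) (f : R -> \bar R) : measurable A ->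
  measurable_fun A f -> (forall y, 0 <= f y)%E ->
  (\int[Q]_(y in A) f y = \int[Q]_(y in A `&` D) f y)%E.
Proof.
move=> mA mf f0.
have -> : A `&` D = A `\` `]-oo, 0]%classic.
  by rewrite setDE setCitvl.
exact: (ge0_negligible_integral (mitv `]-oo, 0]) mA mf _ Qle0).
Qed.

Lemma radon_measure_pos (A : set (measurableTypeR R)) : measurable A -> Q A = Q (A `&` D).
Proof.
move=> mA; have mAD : measurable (A `&` D) by exact: measurableI.
have := @radon_integral_pos A (cst 1%E) mA.
rewrite (integral_cst Q mA) (integral_cst Q mAD) !mul1e; apply => //.
Qed.

Let l t := \int[Q]_(y in D) expR (- (t * y)).

Let laplace_pos t : (laplace Q t = \int[Q]_(y in D) (expR (- (t * y)))%:E)%E.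
Proof.
rewrite /laplace radon_integral_pos//.
have -> // : `[0, +oo[ `&` D = D :> set R.
by apply: setIidr => y; rewrite /= !in_itv/= !andbT => /ltW.
Qed.

Let IE t : 0 < t -> Q.-integrable D (EFin \o (fun y => expR (- (t * y)))).
Proof.
move=> t0; apply: ge0_integrable_EFin => //.
- exact: (measurable_funTS (mE t)).
- by move: (L_fin t0); rewrite laplace_pos.
Qed.

Lemma laplaceE t : 0 < t -> laplace Q t = (\int[Q]_(y in D) expR (- (t * y)))%:E.
Proof. by move=> t0; rewrite laplace_pos (integrable_EFinE mD (IE t0)). Qed.

Let F t := \int[Q]_(y in `]0, a / t]) expR (- (t * y)).

Let subD (b : bool) (v : R) : [set` Interval (BRight 0) (BSide b v)] `<=` D.
Proof. by move=> x; rewrite /= !in_itv/= andbT => /andP[]. Qed.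

Let IF t : 0 < t -> Q.-integrable `]0, a / t] (EFin \o (fun y => expR (- (t * y)))).
Proof. by move=> t0; apply: integrableS (IE t0) => //; exact: subD. Qed.

Let F_ge t : 0 < t -> alpha * l t <= F t.
Proof.
move=> t0; have [_] := quantile t0.
by rewrite laplaceE// (integrable_EFinE (mitv _) (IF t0)) -EFinM lee_fin.
Qed.

(** For s < t the closed interval up to a/t lies inside the open one up to a/s. The first quantile
    inequality at s thus bounds the integral over the closed interval at t. *)
Let F_le s t : 0 < s -> s < t -> F t <= alpha * l s.
Proof.
move=> s0 st; have t0 := lt_trans s0 st; have [+ _] := quantile s0.
have Is : Q.-integrable `]0, a / s[ (EFin \o (fun y => expR (- (s * y)))).
  by apply: integrableS (IE s0) => //; exact: subD.
rewrite laplaceE// (integrable_EFinE (mitv _) Is) -EFinM lee_fin; apply: le_trans.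
apply: (le_subset_Rintegral (mitv _) (mitv _) _ Is (IF t0)).
- move=> y; rewrite /= !in_itv/= => /andP[-> yt] /=.
  by apply: (le_lt_trans yt); rewrite ltr_pM2l// ltf_pV2.
- by move=> y _; exact: expR_ge0.
- move=> y; rewrite /= in_itv/= => /andP[y0 _].
  by rewrite ler_expR lerN2 ler_pM2r// ltW.
Qed.

(** Quantitative left continuity of the Laplace transform. It follows from exp(-x) >= 1 - x; the
    factor y is absorbed by half of the rate s >= t/2, which leaves t/4. *)
Let l_sub s t : 0 < s -> t / 2 <= s -> s < t -> l s <= l t + (t - s) * (4 / t * l (t / 4)).
Proof.
move=> s0 ts st; have t0 := lt_trans s0 st; have t40 : 0 < t / 4 by rewrite divr_gt0.
have -> : (t - s) * (4 / t * l (t / 4)) = (t - s) * (4 / t) * l (t / 4) by ring.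
have I1 := integrable_EFinZ ((t - s) * (4 / t)) mD (IE t40).
rewrite /l -RintegralZl//; last exact: IE.
rewrite -RintegralD//; last exact: IE.
apply: (le_Rintegral mD (IE s0) (integrable_EFinD mD (IE t0) I1)).
move=> y; rewrite /= in_itv/= andbT => y0.
have -> : expR (- (t * y)) = expR (- (s * y)) * expR (- ((t - s) * y)).
  by rewrite -expRD; congr expR; ring.
have e1 := expR_ge1Dx (- ((t - s) * y)).
have e2 := ler_wpM2l (expR_ge0 (- (s * y))) e1.
suff : expR (- (s * y)) * ((t - s) * y) <= (t - s) * (4 / t) * expR (- (t / 4 * y)).
  by move: e2; rewrite mulrDr mulr1 mulrN; lra.
have -> : expR (- (s * y)) * ((t - s) * y) =
    (t - s) * (s^-1 * (s * y * expR (- (s * y)))) by field; rewrite gt_eqF.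
rewrite -[leRHS]mulrA ler_pM2l ?subr_gt0//.
have x0 : 0 <= s * y by rewrite ltW// mulr_gt0.
have -> : 4 / t = (t / 2)^-1 * 2 by field; rewrite gt_eqF.
rewrite -[leRHS]mulrA; apply: ler_pM.
- by rewrite invr_ge0 ltW.
- by rewrite mulr_ge0 ?expR_ge0.
- by rewrite lef_pV2 ?posrE// divr_gt0.
apply: (le_trans (mulr_expRN_le x0)); rewrite ler_pM2l// ler_expR lerN2.
have -> : t / 4 * y = t / 2 * y / 2 by field.
by rewrite ler_pM2r ?invr_gt0// ler_pM2r.
Qed.

(** F(t) lies between alpha l(t) and alpha l(s) for every s < t; letting s increase to t closes the
    gap. *)
Let FE t : 0 < t -> F t = alpha * l t.
Proof.
move=> t0; apply/eqP; rewrite eq_le F_ge// andbT leNgt; apply/negP => lt.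
pose d := F t - alpha * l t; have d0 : 0 < d by rewrite subr_gt0.
pose C := 4 / t * l (t / 4); pose K := alpha * C * (t / 2).
have K0 : 0 <= K.
  rewrite !mulr_ge0 ?invr_ge0 ?(ltW alpha_gt0) ?(ltW t0)//.
  by apply: Rintegral_ge0 => y _; exact: expR_ge0.
have dK : 0 < d + K by rewrite ltr_wpDr.
(* With this step alpha e C = K d / (d + K) < d, so moving from t to t - e costs less than the
   supposed gap d, and e <= t/2 keeps [l_sub] applicable. *)
pose e := t / 2 * (d / (d + K)).
have e0 : 0 < e by rewrite mulr_gt0 ?divr_gt0.
have et : e <= t / 2.
  rewrite ler_piMr//; first by rewrite ltW// divr_gt0.
  by rewrite ler_pdivrMr// mul1r lerDl.
have s0 : 0 < t - e by have := t0; lra.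
have st : t - e < t by have := e0; lra.
have ts : t / 2 <= t - e by have := et; lra.
have h1 := F_le s0 st; have h2 := ler_wpM2l (ltW alpha_gt0) (l_sub s0 ts st).
have h3 : alpha * (e * C) < d.
  have -> : alpha * (e * C) = alpha * C * (t / 2) * d / (d + K) by rewrite /e; ring.
  rewrite -/K.
  by rewrite ltr_pdivrMr// mulrC ltr_pM2l// ltrDr.
move: h2; rewrite -/C mulrDr subKr => h2; move: h3; rewrite /d => h3.
have := le_trans h1 h2; lra.
Qed.

Lemma quantile_balanced : balanced alpha a Q (fun=> 1).
Proof.
split=> // [t t0|t t0].
  have -> // : (fun y => expR (- (t * y)) * 1) = (fun y => expR (- (t * y))).
    by apply/funext => y; rewrite mulr1.
  exact: IE.
have Ipatch : Q.-integrable D (EFin \o ((fun y => expR (- (t * y))) \_ `]0, a / t])).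
  rewrite -restrict_EFin; apply: (integrable_restrict Q (mitv `]0, a / t]) mD _).1.
  by rewrite setIidr; [exact: IF|exact: subD].
transitivity (\int[Q]_(y in D) (((fun y => expR (- (t * y))) \_ `]0, a / t]) y -
    alpha * expR (- (t * y)))).
  apply: eq_Rintegral => y; rewrite inE/= in_itv/= andbT => y0.
  rewrite mulr1 patchE; have [ya|ay] := leP y (a / t).
    rewrite mem_set; last by rewrite /= in_itv/= y0.
    rewrite qker_le ?mulrBl ?mul1r//.
    by rewrite mulrC -ler_pdivlMr.
  rewrite memNset; last by rewrite /= in_itv/= y0/= leNgt ay.
  rewrite qker_gt ?mulNr ?sub0r//.
  by rewrite mulrC -ltr_pdivrMr.
have I2 := integrable_EFinZ alpha mD (IE t0).
rewrite RintegralB//; rewrite RintegralZl//; last exact: IE.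
rewrite -Rintegral_mkcondr.
rewrite setIidr; last exact: subD.
by rewrite -/(F t) FE// subrr.
Qed.

(** * The exponential family of a power density *)

Section power_density.
Variables (p c : R).
Hypotheses (p_gt0 : 0 < p) (c_gt0 : 0 < c).
Hypothesis QE : forall A : set (measurableTypeR R), measurable A -> A `<=` D ->
  (Q A = \int[leb]_(x in A) (c * x `^ (p - 1))%:E)%E.

Let mg : measurable_fun setT (fun x : R => c * x `^ (p - 1)).
Proof. exact: measurable_funM. Qed.

Let g_ge0 (x : R) : 0 <= c * x `^ (p - 1).
Proof. by rewrite mulr_ge0 ?powR_ge0// ltW. Qed.

Let G0 := Gamma_gt0 p_gt0.

Lemma measure_power_density (A : set (measurableTypeR R)) : measurable A ->
  Q A = ((c * Gamma p)%:E * power_measure p A)%E.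
Proof.
move=> mA; have mAD : measurable (A `&` D : set (measurableTypeR R)) by exact: measurableI.
have AD : A `&` D `<=` D by exact: subIsetr.
rewrite radon_measure_pos// QE// /power_measure -(ge0_integralZl leb mAD).
- apply: eq_integral => x _; rewrite -EFinM; congr EFin; field.
  by rewrite gt_eqF.
- by apply/measurable_EFinP/measurable_funTS/measurable_funM.
- by move=> x _; rewrite lee_fin divr_ge0 ?powR_ge0// ltW.
- by rewrite lee_fin mulr_ge0// ltW.
Qed.

Lemma laplace_power_density t : 0 < t -> fine (laplace Q t) = c * Gamma p / t `^ p.
Proof.
move=> t0; rewrite laplaceE//=.
rewrite (Rintegral_density mD mg g_ge0 QE (IE t0)).
have tp : 0 < t `^ p by exact: powR_gt0.
pose f (x : R) := x `^ (p - 1) * expR (- x).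
have If := integrable_powexp p_gt0.
transitivity (\int[leb]_(y in D) (c / t `^ (p - 1) * f (t * y))).
  apply: eq_Rintegral => y; rewrite inE/= in_itv/= andbT => y0.
  rewrite /f powRM ?(ltW t0) ?(ltW y0)//; field.
  by rewrite gt_eqF// powR_gt0.
rewrite RintegralZl//; last exact: (integrable_scale t0 If).
rewrite (Rintegral_scale t0 If) -/(Gamma p) powRB1//; field.
by rewrite !gt_eqF.
Qed.

Lemma exp_family_power_density t (A : set (measurableTypeR R)) : 0 < t -> measurable A ->
  exp_family Q t A = gamma_law p t A.
Proof.
move=> t0 mA; have mAD : measurable (A `&` D : set (measurableTypeR R)) by exact: measurableI.
have AD : A `&` D `<=` D by exact: subIsetr.
have tp : 0 < t `^ p by exact: powR_gt0.
have Lt : 0 < c * Gamma p / t `^ p by rewrite divr_gt0// mulr_gt0.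
rewrite /exp_family laplace_power_density//.
have mf : measurable_fun setT (fun y : R => (expR (- (t * y)) / (c * Gamma p / t `^ p))%:E).
  by apply/measurable_EFinP/measurable_funM => //; exact: mE.
have f0 (y : R) : (0 <= (expR (- (t * y)) / (c * Gamma p / t `^ p))%:E)%E.
  by rewrite lee_fin divr_ge0 ?expR_ge0// ltW.
rewrite radon_integral_pos//; last exact: measurable_funTS.
rewrite (ge0_integral_density (nu := Q) (mu := leb) mAD mg g_ge0)//; last 2 first.
- by move=> B mB BAD; rewrite QE//; exact: subset_trans AD.
- exact: measurable_funTS.
apply: eq_integral => y _; rewrite -EFinM; congr EFin; field.
by rewrite !gt_eqF.
Qed.

End power_density.
End exponential_family.

Unset Implicit Arguments.
Set Strict Implicit.
Set Printing Implicit Defensive.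

Theorem theorem2 (R : realType)
    (Q : {measure set (measurableTypeR R) -> \bar R}) (alpha a : R)
    (Q_radon : radon_nonneg Q)
    (Q_neq0 : (Q [set: R] != 0)%E)
    (L_fin : forall t : R, 0 < t -> (laplace Q t < +oo)%E)
    (alpha_gt0 : 0 < alpha) (alpha_lt1 : alpha < 1) (a_gt0 : 0 < a)
    (quantile : forall t : R, 0 < t ->
      (\int[Q]_(y in `]0%R, (a / t)%R[) (expR (- (t * y)))%:E
         <= alpha%:E * laplace Q t)%E /\
      (alpha%:E * laplace Q t
         <= \int[Q]_(y in `]0%R, (a / t)%R]) (expR (- (t * y)))%:E)%E) :
  exists p : R,
    [/\ 0 < p /\ gamma_cdf p a = alpha%:E,
        forall q : R, 0 < q -> gamma_cdf q a = alpha%:E -> q = p,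
        exists2 c : R, 0 < c &
          forall A : set (measurableTypeR R), measurable A ->
            Q A = (c%:E * power_measure p A)%E
      & forall t : R, 0 < t ->
          forall A : set (measurableTypeR R), measurable A ->
            exp_family Q t A = gamma_law p t A].
Proof.
have [p p0 Mp] := mellin_root alpha_gt0 alpha_lt1 a_gt0.
have bQ := quantile_balanced Q_radon L_fin alpha_gt0 a_gt0 quantile.
have [c c0 QE] := @balanced_powerE R alpha a alpha_gt0 alpha_lt1 a_gt0 p p0 Mp
  (sigma_finite_copy (radon_sigma_finite Q_radon)) bQ.
have {}QE : forall A : set (measurableTypeR R), measurable A -> A `<=` `]0%R, +oo[ ->
  (Q A = \int[@lebesgue_measure R]_(x in A) (c * x `^ (p - 1))%:E)%E by exact: QE.
(* For c = 0 the measure Q would vanish on the open half-line, hence everywhere. *)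
have {}c0 : 0 < c.
  rewrite lt_neqAle c0 andbT; apply/negP => /eqP c_eq0; move/eqP: Q_neq0; apply.
  rewrite (radon_measure_pos Q_radon alpha_gt0 a_gt0 quantile)// QE.
  - by apply: integral0_eq => x _; rewrite -c_eq0 mul0r.
  - by apply: measurableI => //; exact: measurable_itv.
  - exact: subIsetr.
exists p; split.
- by split=> //; exact/gamma_cdf_mellin.
- move=> q q0 /(gamma_cdf_mellin alpha_gt0 alpha_lt1 a_gt0 q0) Mq.
  by case: (ltgtP q p) => // qp; [case: (mellin_inj alpha_gt0 alpha_lt1 a_gt0 q0 qp Mq Mp)|
    case: (mellin_inj alpha_gt0 alpha_lt1 a_gt0 p0 qp Mp Mq)].
- exists (c * Gamma p); first by rewrite mulr_gt0 ?Gamma_gt0.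
  by move=> A mA; exact: (measure_power_density Q_radon alpha_gt0 a_gt0 quantile p0 c0 QE).
- move=> t t0 A mA.
  exact: (exp_family_power_density Q_radon L_fin alpha_gt0 a_gt0 quantile p0 c0 QE).
Qed.
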